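(* Let $k\geq 3$ and let $T$ be the $k$-regular tree. Let $\mathrm{Ell}$ and $\mathrm{Hyp}$ denote the sets of elliptic and of hyperbolic elements of $\mathrm{Aut}(T)$, respectively. Then for a generic elliptic element $a$ and a generic hyperbolic element $b$ one has $$\mathrm{Aut}^{0}(T)\subseteq \overline{\langle a,b\rangle };$$ that is, the set of pairs $(a,b)\in \mathrm{Ell}\times \mathrm{Hyp}$ for which this inclusion fails is meager and has $\mu^2$-measure $0$.
   Context: $\mathrm{Aut}(T)$ carries the topology of pointwise convergence on vertices; $\mu$ is the Haar measure on $\mathrm{Aut}(T)$ normalized so that vertex stabilizers have measure $1$, and $\mu^2$ is the product measure on $\mathrm{Aut}(T)^2$. $\mathrm{Aut}^0(T)$ is the index $2$ subgroup of automorphisms preserving each class of the bipartition of $T$. The bar denotes closure in $\mathrm{Aut}(T)$. Convention: inversions are counted as elliptic, i.e. an element of $\mathrm{Aut}(T)$ is elliptic if it fixes a vertex or a geometric edge (an unordered pair of adjacent vertices, preserved as a set) of $T$; equivalently it fixes a vertex of the barycentric subdivision of $T$. All other elements are hyperbolic. *)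

(* Defs.v *)
From HB Require Import structures.
From mathcomp Require Import all_boot all_order all_algebra.
From mathcomp Require Import all_classical all_reals all_analysis.

Set Implicit Arguments.
Unset Strict Implicit.
Unset Printing Implicit Defensive.

Local Open Scope classical_set_scope.
Local Open Scope ring_scope.

(* Vertices form a choiceType and adjacency is boolean only for compatibility
   with the library; classically this is no restriction, and the vertex set may
   be infinite. *)
Record sgraph := SGraph {
  vertex :> choiceType;
  adj : rel vertex;
  adj_sym : symmetric adj;
  adj_irr : irreflexive adj }.

(* [ucycle e c] says that [c] lists, without repetition, the vertices of a
   closed walk; those with one or two vertices do not count as graph cycles. *)
Definition is_tree (T : sgraph) : Prop :=
  [/\ [set: T] !=set0,
      forall x y : T, exists2 p, path (@adj T) x p & last x p = y
    & forall c : seq T, ucycle (@adj T) c -> (size c <= 2)%N].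

Definition regular_graph (k : nat) (T : sgraph) : Prop :=
  forall x : T, ([set y | adj x y] #= `I_k)%card.

Record autom (T : sgraph) := Autom {
  autom_fun :> T -> T;
  autom_bij : bijective autom_fun;
  autom_adj : forall x y, adj (autom_fun x) (autom_fun y) = adj x y }.

Section AutGroup.
Context (T : sgraph).
Implicit Types g h : autom T.

HB.instance Definition _ := gen_eqMixin (autom T).
HB.instance Definition _ := gen_choiceMixin (autom T).

Lemma autom_eq g h : g =1 h -> g = h.
Proof.
case: g h => [f fb fa] [f' fb' fa'] /= /funext ff'; subst f'.
by rewrite (Prop_irrelevance fb fb') (Prop_irrelevance fa fa').
Qed.

Definition autom_one : autom T :=
  @Autom T id (Bijective (fun=> erefl) (fun=> erefl)) (fun _ _ => erefl).

Lemma autom_mul_adj g h x y : adj ((g \o h) x) ((g \o h) y) = adj x y.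
Proof. by rewrite /= !autom_adj. Qed.

Definition autom_mul g h : autom T :=
  Autom (bij_comp (autom_bij g) (autom_bij h)) (autom_mul_adj g h).

Lemma autom_invP g : exists f : T -> T, cancel g f /\ cancel f g.
Proof. by case: (autom_bij g) => f gf fg; exists f. Qed.

Definition autom_inv_fun g : T -> T := projT1 (cid (autom_invP g)).

Lemma autom_inv_funK g : cancel g (autom_inv_fun g).
Proof. by rewrite /autom_inv_fun; case: cid => f []. Qed.

Lemma autom_inv_funVK g : cancel (autom_inv_fun g) g.
Proof. by rewrite /autom_inv_fun; case: cid => f []. Qed.

Lemma autom_inv_adj g x y :
  adj (autom_inv_fun g x) (autom_inv_fun g y) = adj x y.
Proof. by rewrite -(autom_adj g) !autom_inv_funVK. Qed.

Definition autom_inv g : autom T :=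
  Autom (Bijective (autom_inv_funVK g) (autom_inv_funK g)) (autom_inv_adj g).

Lemma autom_mulA : associative autom_mul.
Proof. by move=> f g h; apply: autom_eq. Qed.

Lemma autom_mul1g : left_id autom_one autom_mul.
Proof. by move=> g; apply: autom_eq. Qed.

Lemma autom_mulg1 : right_id autom_one autom_mul.
Proof. by move=> g; apply: autom_eq. Qed.

Lemma autom_mulVg : left_inverse autom_one autom_inv autom_mul.
Proof. by move=> g; apply: autom_eq => x; exact: autom_inv_funK. Qed.

Lemma autom_mulgV : right_inverse autom_one autom_inv autom_mul.
Proof. by move=> g; apply: autom_eq => x; exact: autom_inv_funVK. Qed.

HB.instance Definition _ := isGroup.Build (autom T)
  autom_mulA autom_mul1g autom_mulg1 autom_mulVg autom_mulgV.

HB.instance Definition _ := isPointed.Build (autom T) autom_one.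

Definition autom_ptws (g : autom T) : {ptws T -> discrete_topology T} := g.

HB.instance Definition _ :=
  Topological.copy (autom T) (initial_topology autom_ptws).

(* The measurable structure on [autom T] is the Borel sigma-algebra. *)
HB.instance Definition _ := Measurable.copy (autom T)
  (g_sigma_algebraType (@open (autom T))).

End AutGroup.

Definition is_subgroup (G : groupType) (H : set G) : Prop :=
  [/\ H 1%g, forall x y, H x -> H y -> H (x * y)%g
    & forall x, H x -> H x^-1%g].

Definition generated_subgroup (G : groupType) (A : set G) : set G :=
  smallest (@is_subgroup G) A.

Definition nowhere_dense (X : topologicalType) (A : set X) : Prop :=
  (closure A)° = set0.

Definition meager (X : topologicalType) (A : set X) : Prop :=
  exists2 F : nat -> set X, (forall n, nowhere_dense (F n))
                          & A = \bigcup_n F n.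

(* [A] and its complement are the two classes of a bipartition.  A tree has
   exactly two such sets [A], complementary to each other. *)
Definition bipartition_class (T : sgraph) (A : set T) : Prop :=
  forall x y : T, adj x y -> (A x <-> ~ A y).

Definition aut0 (T : sgraph) : set (autom T) :=
  [set g | forall A : set T, bipartition_class A -> g @` A = A].

(* Inversions of an edge count as elliptic. *)
Definition elliptic (T : sgraph) : set (autom T) :=
  [set g | (exists x : T, g x = x) \/
           exists2 e : T * T, adj e.1 e.2
                            & g @` [set e.1; e.2] = [set e.1; e.2]].

Definition hyperbolic (T : sgraph) : set (autom T) := ~` @elliptic T.

Definition vertex_stabilizer (T : sgraph) (v : T) : set (autom T) :=
  [set g | g v = v].

(* For locally finite connected [T] the group [autom T] is locally compact and
   second countable, so regularity of the measure is automatic. *)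
Definition haar_measure (R : realType) (T : sgraph)
    (mu : set (autom T) -> \bar R) : Prop :=
  [/\ forall (g : autom T) (A : set (autom T)), measurable A ->
        mu ((fun h => g * h)%g @` A) = mu A,
      forall K : set (autom T), compact K -> (mu K < +oo)%E
    & forall U : set (autom T), open U -> U !=set0 -> (0%E < mu U)%E].

(* Main.v *)
(* The inclusion holds for every hyperbolic b and almost every elliptic a.

   Let Y be a half-tree bounded by an edge of the axis of b, and let g be an
   automorphism supported on Y.  High powers of b or b^-1 carry Y to a half-tree
   Z = b^-j Y disjoint from any prescribed finite set.  As a is elliptic, some
   power of it maps Z onto itself; let c > 0 be the first return.  Composing a with
   an automorphism f supported on Z replaces a^c by f a^c on Z, so b^j (f a)^c b^-j
   can be made to agree with g on a given finite set, and the number of candidates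
   for f needed for this does not depend on Z.

   Let B be the closed set of those elliptic a for which no b^j a^c b^-j agrees
   with g on that finite set, and let D_n be the set of a which agree with some
   element of B on the ball of radius n.  By left invariance of mu,
   mu(B) <= mu(D_n) <= M mu(D_n \ B) with M independent of n; since the D_n decrease
   to B, this gives mu(B) = 0.  Being closed, B contains no open set, as these have
   positive measure, so that meagerness follows as well.

   Hence for almost every a the closure of <a, b> contains all automorphisms
   supported on a half-tree bounded by an axis edge.  For a vertex u of the axis,
   those on the two sides of u generate the stabilizer of u, because k >= 3; the
   stabilizers of two adjacent vertices give all vertex stabilizers, and these
   generate Aut^0(T). *)
Require Import Defs.
From HB Require Import structures.
From mathcomp Require Import all_boot all_order all_algebra.
From mathcomp Require Import all_classical all_reals all_analysis.

Set Implicit Arguments.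
Unset Strict Implicit.
Unset Printing Implicit Defensive.

Import Order.TTheory GRing.Theory Num.Theory.

Local Open Scope classical_set_scope.
Local Open Scope ring_scope.

(** * Half-trees *)

Section AutomTheory.
Context (T : sgraph).
Implicit Types (g h : autom T) (w : T).

Lemma automM g h w : (g * h)%g w = g (h w).
Proof. by []. Qed.

Lemma automK g w : (g^-1)%g (g w) = w.
Proof. exact: autom_inv_funK. Qed.

Lemma automVK g w : g ((g^-1)%g w) = w.
Proof. exact: autom_inv_funVK. Qed.

Lemma autom_inj g : injective g.
Proof. exact: bij_inj (autom_bij g). Qed.

Lemma automX1 g m w : g ((g ^+ m)%g w) = (g ^+ m.+1)%g w.
Proof. by rewrite expgS automM. Qed.

Lemma automXK g m w : (g^-1 ^+ m)%g ((g ^+ m)%g w) = w.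
Proof. by rewrite expVgn automK. Qed.

Lemma automXVK g m w : (g ^+ m)%g ((g^-1 ^+ m)%g w) = w.
Proof. by rewrite expVgn automVK. Qed.

Lemma image_autom g (Y : set T) w : (g @` Y) w <-> Y ((g^-1)%g w).
Proof.
split=> [[v Yv <-]|Yw]; first by rewrite automK.
by exists ((g^-1)%g w) => //; rewrite automVK.
Qed.

End AutomTheory.

Lemma nat_seq_collision (I : eqType) (u : nat -> I) (s : seq I) :
  (forall n, u n \in s) -> exists n m, (n < m)%N /\ u n = u m.
Proof.
move=> us; have : ~~ uniq (map u (iota 0 (size s).+1)).
  apply/negP => U; have : {subset map u (iota 0 (size s).+1) <= s}.
    by move=> _ /mapP[n _ ->].
  by move=> /(uniq_leq_size U); rewrite size_map size_iota ltnn.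
case/(uniqPn (u 0%N)) => i [j [ij]]; rewrite size_map size_iota => js.
have is_ := ltn_trans ij js.
by rewrite !(nth_map 0%N) ?size_iota// !nth_iota//; exists i, j.
Qed.

Section Cuts.
Context (T : sgraph) (hT : is_tree T).
Implicit Types (x y w p q e : T) (Y Z : set T) (g h : autom T) (s : seq T).

Lemma tree_connected Y x :
  (forall v w, adj v w -> Y v -> Y w) -> Y x -> forall y, Y y.
Proof.
move=> Ycl Yx y; have [_ /(_ x y)[s xs <-] _] := hT.
elim: s x xs Yx => //= z s IH x /andP[xz zs] Yx.
by apply: IH => //; exact: Ycl xz Yx.
Qed.

(* [Y] is the half-tree on the side of [p] of the edge [{p, p'}]. *)
Definition cut p' p Y :=
  [/\ adj p p', Y p, ~ Y p' &
      forall v w, adj v w -> Y v -> ~ Y w -> v = p /\ w = p'].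

Lemma cutC p' p Y : cut p' p Y -> cut p p' (~` Y).
Proof.
case=> a Yp Yp' c; split=> //; first by rewrite adj_sym.
by move=> v w vw nYv /contrapT Yw; rewrite adj_sym in vw; case: (c w v vw Yw nYv).
Qed.

Lemma cut_image g p' p Y : cut p' p Y -> cut (g p') (g p) (g @` Y).
Proof.
case=> a Yp Yp' c; split.
- by rewrite autom_adj.
- by exists p.
- by rewrite image_autom automK.
- move=> v w; rewrite !image_autom -(autom_adj (g^-1)%g) => vw Yv Yw.
  by have [<- <-] := c _ _ vw Yv Yw; rewrite !automVK.
Qed.

Definition branch p' p : set T :=
  [set w | exists2 s, path (@adj T) p s /\ last p s = w & p' \notin p :: s].

(** An edge leaving the branch ends at [p'], since otherwise the path could be extended. If it
    started at some [v] other than [p], a simple path from [p] to [v] would close up through [p'] to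
    a cycle with at least three vertices. *)
Lemma branch_cut p' p : adj p p' -> cut p' p (branch p' p).
Proof.
move=> pp'.
have np : p' != p by apply/eqP => E; rewrite E adj_irr in pp'.
split=> //.
- by exists [::] => //; rewrite inE.
- by case=> s [_ <-]; rewrite mem_last.
- move=> v w vw [s [ps lv] ns] nw.
  have wp' : w = p'.
    apply: contrapT => /eqP wp'; apply: nw; exists (rcons s w).
      by rewrite rcons_path last_rcons ps lv.
    by rewrite -rcons_cons mem_rcons in_cons negb_or eq_sym wp'.
  split=> //; subst w.
  case: (shortenP ps) lv => s' ps' us' ss' lv'.
  apply: contrapT => vp.
  have [_ _ /(_ (p' :: p :: s'))] := hT.
  have ns' : p' \notin p :: s'.
    apply: contra ns; rewrite !inE => /orP[->//|/ss' ->]; exact: orbT.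
  have uc : ucycle (@adj T) (p' :: p :: s').
    apply/andP; split; last by rewrite cons_uniq ns'.
    by rewrite /= rcons_path (adj_sym p' p) pp' ps' lv' vw.
  move=> /(_ uc); case: s' {ps' us' ss' ns' uc} lv' => //= E _; exact: vp.
Qed.

(** The difference of [Y] and [Z] is closed under adjacency, because the only edge out of [Y] starts
    at [p] and the only edge out of [Z] ends at [p']. If it were nonempty, it would be all of [T] by
    connectedness, yet it misses [p]. *)
Lemma cut_unique p' p Y Z : cut p' p Y -> cut p' p Z -> Y `<=` Z.
Proof.
move=> [_ Yp Yp' cY] [_ Zp Zp' cZ] w Yw; apply: contrapT => Zw.
suff : forall v, Y v /\ ~ Z v by move=> /(_ p)[].
apply: (@tree_connected _ w) => // v u vu [Yv Zv]; split.
  by apply: contrapT => Yu; have [E _] := cY _ _ vu Yv Yu; apply: Zv; rewrite E.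
move=> Zu; rewrite adj_sym in vu; have [_ E] := cZ _ _ vu Zu Zv.
by apply: Yp'; rewrite -E.
Qed.

Lemma cut_eq p' p Y Z : cut p' p Y -> cut p' p Z -> Y = Z.
Proof.
by move=> cY cZ; apply/seteqP; split; [exact: cut_unique cY cZ|exact: cut_unique cZ cY].
Qed.

(* A half-tree is connected: if it meets both sides of another edge then it
   contains that edge. *)
Lemma cut_cross p' p Y q' q Z v w : cut p' p Y -> cut q' q Z ->
  Y v -> Z v -> Y w -> ~ Z w -> Y q.
Proof.
move=> [_ Yp Yp' cY] [_ Zq Zq' cZ] Yv Zv Yw Zw; apply: contrapT => Yq.
have [Zp|Zp] := pselect (Z p).
  suff : forall u, Y u /\ ~ Z u by move=> /(_ v)[].
  apply: (@tree_connected _ w) => // a b ab [Ya Za]; split.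
    by apply: contrapT => Yb; have [E _] := cY _ _ ab Ya Yb; apply: Za; rewrite E.
  move=> Zb; have Yb : Y b.
    by apply: contrapT => Yb; have [E _] := cY _ _ ab Ya Yb; apply: Za; rewrite E.
  by rewrite adj_sym in ab; have [E _] := cZ _ _ ab Zb Za; apply: Yq; rewrite -E.
suff : forall u, Y u /\ Z u by move=> /(_ w)[].
apply: (@tree_connected _ v) => // a b ab [Ya Za].
have Yb : Y b.
  by apply: contrapT => Yb; have [E _] := cY _ _ ab Ya Yb; apply: Zp; rewrite -E.
split=> //; apply: contrapT => Zb.
by have [E _] := cZ _ _ ab Za Zb; apply: Yq; rewrite -E.
Qed.

(** If neither inclusion held, [cut_cross] would put [q] inside [Y] and, applied to the complement
    of [Y], also outside [Y]. *)
Lemma cut_nested p' p Y q' q Z w e : cut p' p Y -> cut q' q Z ->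
  ~ Y e -> ~ Z e -> Y w -> Z w -> Y `<=` Z \/ Z `<=` Y.
Proof.
move=> cY cZ Ye Ze Yw Zw.
have [|nYZ] := pselect (Y `<=` Z); [by left|right => v Zv].
apply: contrapT => Yv.
apply: nYZ => u Yu; apply: contrapT => Zu.
have Yq := cut_cross cY cZ Yw Zw Yu Zu.
exact: (cut_cross (cutC cY) cZ Yv Zv Ye Ze).
Qed.

Lemma cut_path p' p Y x s : cut p' p Y -> path (@adj T) x s ->
  ~ Y x -> Y (last x s) -> p' \in x :: s /\ p \in x :: s.
Proof.
move=> [_ Yp Yp' cY]; elim: s x => [|z s IH] x //= /andP[xz zs] Yx Yl.
have [Yz|Yz] := pselect (Y z).
  rewrite adj_sym in xz.
  by have [<- <-] := cY _ _ xz Yz Yx; rewrite !inE !eqxx orbT.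
by have [p's ps] := IH z zs Yz Yl; rewrite !(inE, orbC (_ == x)) -!in_cons p's ps.
Qed.

Definition supported Y g := forall w, ~ Y w -> g w = w.
Definition preserves Y g := forall w, Y (g w) <-> Y w.

Lemma supported_preserves Y g : supported Y g -> preserves Y g.
Proof.
move=> sg w; split=> [Yg|Yw]; apply: contrapT => nY.
  by apply: (nY); rewrite -(sg _ nY).
by have E := autom_inj (sg _ nY); rewrite E in nY.
Qed.

Lemma supportedS Y Z g : Y `<=` Z -> supported Y g -> supported Z g.
Proof. by move=> YZ sg w nZ; apply: sg => /YZ. Qed.

Lemma preserves_edge p' p Y g : cut p' p Y -> preserves Y g ->
  g p = p /\ g p' = p'.
Proof.
move=> [a Yp Yp' cY] pg; apply: cY.
- by rewrite autom_adj.
- exact/pg.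
- by move=> /pg.
Qed.

Lemma preservesM Y g h : preserves Y g -> preserves Y h -> preserves Y (g * h)%g.
Proof. by move=> pg ph w; rewrite automM pg. Qed.

Lemma preservesV Y g : preserves Y g -> preserves Y (g^-1)%g.
Proof. by move=> pg w; rewrite -(pg ((g^-1)%g w)) automVK. Qed.

(** Pasting [g] on [Y] with the identity elsewhere keeps adjacency, because [g] fixes the end [p] of
    the only edge leaving [Y]. *)
Lemma restriction p' p Y g : cut p' p Y -> preserves Y g ->
  exists2 h, supported Y h & forall w, Y w -> h w = g w.
Proof.
move=> cY pg; have [gp _] := preserves_edge cY pg.
pose r f w : T := if `[< Y w >] then f w else w.
have rY (f : autom T) w : Y w -> r f w = f w.
  by move=> Yw; rewrite /r; case: asboolP.
have rN (f : autom T) w : ~ Y w -> r f w = w.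
  by move=> Yw; rewrite /r; case: asboolP.
have rK (f f' : autom T) : preserves Y f -> cancel f f' -> cancel (r f) (r f').
  move=> pf ff' w; have [Yw|Yw] := pselect (Y w).
    by rewrite (rY f) // rY ?ff' //; apply/pf.
  by rewrite !rN // rN.
have rbij : bijective (r g).
  exists (r (g^-1)%g); first exact: rK (automK g).
  by apply: rK (automVK g); apply: preservesV.
have radj x y : adj (r g x) (r g y) = adj x y.
  case: cY => pp' Yp Yp' cY.
  have mix a b : Y a -> ~ Y b -> adj (g a) b = adj a b.
    move=> Ya Yb; apply/idP/idP => ab.
      have [E1 E2] := cY _ _ ab ((pg a).2 Ya) Yb.
      have -> : a = p by apply: (@autom_inj _ g); rewrite E1 gp.
      by rewrite E2.
    by have [-> ->] := cY _ _ ab Ya Yb; rewrite gp.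
  have [Yx|Yx] := pselect (Y x); have [Yy|Yy] := pselect (Y y).
  - by rewrite !rY // autom_adj.
  - by rewrite rY // rN // mix.
  - by rewrite rN // rY // adj_sym mix // adj_sym.
  - by rewrite !rN.
exists (Autom rbij radj) => w Yw /=; [exact: rN | exact: rY].
Qed.

End Cuts.

(** * The axis of a hyperbolic automorphism *)

Section Axis.
Context (T : sgraph) (hT : is_tree T).
Implicit Types (x y z u v w : T) (Y : set T) (b : autom T) (s t : seq T).

(* The edge [{x, x'}] lies on the axis of [b], which translates it away from
   the half-tree [Y] of [x]. *)
Definition shifts b x' x Y :=
  [/\ cut x' x Y, ~ Y (b x), ~ Y (b x') & Y ((b^-1)%g x)].

Section Shifts.
Context b x' x Y (bY : shifts b x' x Y).

(** Otherwise the connected set [Y] would meet [b Y], at [x], as well as its complement, and so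
    would contain the root [b x] of [b Y]. *)
Lemma shifts_sub w : Y w -> Y ((b^-1)%g w).
Proof.
case: bY => cY Yx Yx' Yv Yw; have [_ Y1 _ _] := cY.
rewrite -image_autom; apply: contrapT => nw; apply: Yx.
apply: (cut_cross hT cY (cut_image b cY) Y1 _ Yw nw).
by rewrite image_autom.
Qed.

Lemma shifts_subX n w : Y w -> Y ((b^-1 ^+ n)%g w).
Proof.
elim: n => [|n IH] Yw; first by rewrite expg0.
by rewrite expgS automM; apply/shifts_sub/IH.
Qed.

Lemma shifts_notX n w : ~ Y w -> ~ Y ((b ^+ n)%g w).
Proof. by move=> nY /(@shifts_subX n); rewrite automXK. Qed.

Lemma shifts_root n : ~ Y ((b ^+ n.+1)%g x).
Proof. by rewrite expgSr automM; apply: shifts_notX; case: bY. Qed.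

Lemma shifts_orbit n m : (n < m)%N -> (b ^+ n)%g x <> (b ^+ m)%g x.
Proof.
move=> nm; rewrite -(subnKC nm) addSnnS expgnDr automM => /autom_inj E.
by apply: (@shifts_root (m - n.+1)%N); rewrite -E; case: bY => -[].
Qed.

Lemma shifts_orbitV n m : (n < m)%N -> (b^-1 ^+ n)%g x <> (b^-1 ^+ m)%g x.
Proof.
move=> nm; rewrite -(subnKC nm) addSnnS expgnDr automM => /autom_inj E.
by apply: (@shifts_root (m - n.+1)%N); rewrite {1}E automXVK; case: bY => -[].
Qed.

(** All half-trees [b^n Y] contain [x]. If none contained [w], a path from [x] to [w] would leave
    each of them and so pass through every [b^n x], but these are infinitely many distinct
    vertices. *)
Lemma shifts_exhaust w : exists n, Y ((b^-1 ^+ n)%g w).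
Proof.
apply: contrapT => /forallNP nYw.
have [_ /(_ x w)[s xs lw] _] := hT; case: (bY) => cY _ _ _; have [_ Yx _ _] := cY.
suff /nat_seq_collision[n [m [nm]]] : forall n, (b ^+ n)%g x \in x :: s.
  exact: shifts_orbit.
move=> n; have cn := cutC (cut_image (b ^+ n)%g cY).
apply: (cut_path cn xs _ _).1.
  by apply; rewrite image_autom -expVgn; exact: shifts_subX.
by rewrite lw => -/image_autom; rewrite -expVgn; exact: nYw.
Qed.

(** As for [shifts_exhaust], with a path from [x'] to [w] that would have to enter every half-tree
    [b^-n Y]. *)
Lemma shifts_escape w : exists n, ~ Y ((b ^+ n)%g w).
Proof.
apply: contrapT => /forallNP nYw.
have {}nYw n : Y ((b ^+ n)%g w) by apply: contrapT; exact: nYw.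
have [_ /(_ x' w)[s xs lw] _] := hT; case: (bY) => cY _ _ _; have [_ _ Yx' _] := cY.
suff /nat_seq_collision[n [m [nm]]] : forall n, (b^-1 ^+ n)%g x \in x' :: s.
  exact: shifts_orbitV.
move=> n; have cn := cut_image (b^-1 ^+ n)%g cY.
apply: (cut_path cn xs _ _).2.
  by rewrite image_autom expVgn invgK; exact: shifts_notX.
by rewrite lw image_autom expVgn invgK.
Qed.

Lemma shifts_exhaust_seq s : exists n, forall w, w \in s -> Y ((b^-1 ^+ n)%g w).
Proof.
elim: s => [|w s [n IH]]; first by exists 0%N.
have [m Ym] := shifts_exhaust w; exists (n + m)%N => v.
rewrite inE => /orP[/eqP->|/IH Yv].
  by rewrite expgnDr automM; exact: shifts_subX.
by rewrite addnC expgnDr automM; exact: shifts_subX.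
Qed.

Lemma shifts_escape_seq s : exists n, forall w, w \in s -> ~ Y ((b ^+ n)%g w).
Proof.
elim: s => [|w s [n IH]]; first by exists 0%N.
have [m Ym] := shifts_escape w; exists (n + m)%N => v.
rewrite inE => /orP[/eqP->|/IH Yv].
  by rewrite expgnDr automM; exact: shifts_notX.
by rewrite addnC expgnDr automM; exact: shifts_notX.
Qed.

End Shifts.

(** For hyperbolic [b] the size of [s] is the translation length and [u :: s] is a segment of the
    axis: the minimum is taken over all vertices [v] of the tree. *)
Definition min_displacement b u s := [/\ path (@adj T) u s, last u s = b u &
  forall v t, path (@adj T) v t -> last v t = b v -> (size s <= size t)%N].

Lemma hyperbolic_moves b u : hyperbolic b -> b u <> u.
Proof. by move=> hb E; apply: hb; left; exists u. Qed.

Lemma hyperbolic_no_inversion b u v : hyperbolic b -> adj u v ->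
  b u = v -> b v <> u.
Proof.
move=> hb uv buv bvu; apply: hb; right; exists (u, v) => //=.
by rewrite image_setU !image_set1 buv bvu setUC.
Qed.

Lemma hyperbolicV b : hyperbolic b -> hyperbolic (b^-1)%g.
Proof.
move=> hb [[x E]|[[u v] /= uv E]].
  by apply: (hyperbolic_moves (u := x) hb); rewrite -{1}E automVK.
apply: hb; right; exists (u, v) => //=; rewrite -{1}E.
apply/seteqP; split=> [_ [_ [w ew <-] <-]|w ew]; first by rewrite automVK.
by exists ((b^-1)%g w); [exists w|rewrite automVK].
Qed.

Lemma min_displacement_exists b : hyperbolic b ->
  exists u y s, min_displacement b u (y :: s).
Proof.
move=> hb; have [[x _] conn _] := hT.
pose P n := `[< exists u s, [/\ path (@adj T) u s, last u s = b u & size s = n] >].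
have exP : exists n, P n.
  by have [s xs ls] := conn x (b x); exists (size s); apply/asboolP; exists x, s.
case: (ex_minnP exP) => n /asboolP[u [[|y s] [us ls ns]]] nmin.
  by have := hyperbolic_moves (u := u) hb; rewrite -ls.
exists u, y, s; split=> // v t vt lt; rewrite ns; apply: nmin.
by apply/asboolP; exists v, t.
Qed.

(** Dropping the first step and appending its image slides the segment one step along the axis. The
    length, and with it minimality, is unchanged. *)
Lemma min_displacement_next b u y s : min_displacement b u (y :: s) ->
  min_displacement b y (rcons s (b y)).
Proof.
move=> [/= /andP[uy ys] ls mins]; split.
- by rewrite rcons_path ys ls autom_adj.
- by rewrite last_rcons.
- by move=> v t vt lt; rewrite size_rcons; exact: mins vt lt.
Qed.

Lemma min_displacement_uniq b u s : min_displacement b u s -> uniq (u :: s).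
Proof.
move=> [us ls mins]; case: (shortenP us) ls => t ut uut tsub lt.
apply: (leq_size_uniq uut).
  by move=> w; rewrite !inE => /orP[->//|/tsub ->]; rewrite orbT.
by rewrite /= ltnS; exact: mins ut lt.
Qed.

(** The reversed path runs from [b u] to [u]; applying [b^-1] turns it into a path from [u] to
    [b^-1 u]. *)
Lemma min_displacementV b u s : min_displacement b u s ->
  min_displacement (b^-1)%g u (map (b^-1)%g (rev (belast u s))).
Proof.
have revp v t : path (@adj T) v t -> path (@adj T) (last v t) (rev (belast v t)).
  by rewrite rev_path; apply: sub_path => a c /=; rewrite adj_sym.
have lastr v t : last (last v t) (rev (belast v t)) = v.
  by case: t => //= y t; rewrite rev_cons last_rcons.
move=> [us ls mins]; have E : u = (b^-1)%g (last u s) by rewrite ls automK.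
split.
- rewrite {1}E path_map; apply: sub_path (revp _ _ us) => v w vw.
  exact: etrans (autom_adj _ _ _) vw.
- by rewrite {1}E last_map lastr.
- move=> v t vt lt; rewrite size_map size_rev size_belast.
  have := mins _ _ (revp _ _ vt).
  by rewrite lastr lt automVK size_rev size_belast => /(_ erefl).
Qed.

(** If [b y] were [u], the minimal length would be one, so [b] would exchange [u] and [y], an
    inversion. The other coincidences contradict the simplicity of the segment slid by one step. *)
Lemma min_displacement_fresh b u y s : hyperbolic b ->
  min_displacement b u (y :: s) -> b y \notin [:: u, y & s].
Proof.
move=> hb md; rewrite inE negb_or; apply/andP; split; last first.
  have := min_displacement_uniq (min_displacement_next md).
  by rewrite -rcons_cons rcons_uniq => /andP[].
have [/= /andP[uy ys] ls mins] := md; apply/eqP => byu.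
have [] := hyperbolic_no_inversion hb uy _ byu.
have := mins y [:: u]; rewrite /= adj_sym uy byu => /(_ isT erefl).
by case: s ls {md ys mins} => //= <-.
Qed.

(** A path from [y] that avoids [u] cannot enter the half-tree of [u]; this settles [b u] and [b y].
    If [b^-1 u] were outside, the segment from [u] to [b u] would enter the translated half-tree
    through [b y], against [min_displacement_fresh]. *)
Lemma min_displacement_shifts b u y s : hyperbolic b ->
  min_displacement b u (y :: s) -> shifts b y u (branch y u).
Proof.
move=> hb md; have fr := min_displacement_fresh hb md.
have /andP[uF _] := min_displacement_uniq md.
have [uys ls _] := md; have /= /andP[uy ys] := uys.
have cY : cut y u (branch y u) by exact: branch_cut.
have [_ _ nYy _] := cY.
split=> //.
- move=> Yb; move: uF; rewrite (cut_path cY ys nYy _).2 //.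
  by move: ls => /= ->.
- move=> Yb; have [/= ys' ls' _] := min_displacement_next md.
  have := (cut_path cY ys' nYy _).2; rewrite ls' => /(_ Yb).
  rewrite -rcons_cons mem_rcons in_cons (negbTE uF) orbF => /eqP E.
  by move: fr; rewrite -E !inE eqxx.
- rewrite -image_autom; apply: contrapT => nu.
  move: fr; rewrite (cut_path (cut_image b cY) uys nu _).1 // ls.
  by exists u => //; case: cY.
Qed.

Lemma axis_edges b u y s : hyperbolic b -> min_displacement b u (y :: s) ->
  exists2 z, z <> y &
    shifts b y u (branch y u) /\ shifts (b^-1)%g z u (branch z u).
Proof.
move=> hb md; have sh := min_displacement_shifts hb md.
have := min_displacementV md.
have := min_displacement_fresh hb md.
have : forall w, w \in belast u (y :: s) -> w \in [:: u, y & s] by exact: mem_belast.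
(* Here [v] is the vertex just before [b u] on the segment, so [b^-1 v] is the predecessor of [u] on
   the axis. *)
case: (lastP (belast u (y :: s))) (size_belast u (y :: s)) => // t v _ sub fr.
rewrite rev_rcons map_cons => mdV.
exists ((b^-1)%g v); last first.
  by split=> //; exact: min_displacement_shifts (hyperbolicV hb) mdV.
move=> E; have byv : b y = v by rewrite -E automVK.
by move: fr; rewrite byv sub // mem_rcons inE eqxx.
Qed.

End Axis.

(** * Branches of regular trees and generation by stabilizers *)

Section Regular.
Context (T : sgraph) (hT : is_tree T) (k : nat) (nbr : T -> seq T).
Hypothesis nbr_adj : forall x y, (y \in nbr x) = adj x y.
Hypothesis nbr_uniq : forall x, uniq (nbr x).
Hypothesis nbr_size : forall x, size (nbr x) = k.
Implicit Types (x y z u v w p q : T) (Y : set T) (g h : autom T).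

Lemma branchC p' p : adj p p' -> branch p p' = ~` branch p' p.
Proof.
move=> pp'; have pp'' : adj p' p by rewrite adj_sym.
refine (cut_eq hT (branch_cut hT pp'') (cutC (branch_cut hT pp'))).
Qed.

Lemma branch_root p' p : adj p p' -> branch p' p p.
Proof. by case/(branch_cut hT). Qed.

Lemma branch_outer p' p : adj p p' -> ~ branch p' p p'.
Proof. by case/(branch_cut hT). Qed.

Lemma branch_sub p' p q : adj p p' -> adj p q -> q <> p' ->
  branch p q `<=` branch p' p.
Proof.
move=> pp' pq qp' w Zw; apply: contrapT => Yw; have qp : adj q p by rewrite adj_sym.
have cY := branch_cut hT pp'; have [_ Yp _ bY] := cY.
have Yq : branch p' p q by apply: contrapT => Yq; apply: qp'; case: (bY _ _ pq Yp Yq).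
apply: (branch_outer qp).
exact: (cut_cross hT (branch_cut hT qp) cY (branch_root qp) Yq Zw Yw).
Qed.

Lemma branch_disjoint p q r w : adj p q -> adj p r -> q <> r ->
  branch p q w -> ~ branch p r w.
Proof.
move=> pq pr qr /(branch_sub pr pq qr) Yw; rewrite (branchC pr); exact.
Qed.

Lemma preserves_of_edge p' p Y g : cut p' p Y -> g p = p -> g p' = p' ->
  preserves Y g.
Proof.
move=> cY gp gp' w; have := cut_image g cY; rewrite gp gp' => cY'.
by rewrite -{1}(cut_eq hT cY' cY) image_autom automK.
Qed.

(* A directed edge [e = (v', v)] stands for the half-tree of [v]; its vertices
   are coded by the words over ['I_k.-1]. *)
Definition child (e : T * T) (i : 'I_k.-1) : T * T :=
  (e.2, nth e.2 (rem e.1 (nbr e.2)) i).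

Definition decode e s : T * T := foldl child e s.

Lemma decode_rcons e s i : decode e (rcons s i) = child (decode e s) i.
Proof. exact: foldl_rcons. Qed.

Lemma size_rem_nbr e : adj e.2 e.1 -> size (rem e.1 (nbr e.2)) = k.-1.
Proof. by move=> ae; rewrite size_rem ?nbr_size // nbr_adj. Qed.

Lemma child_mem e i : adj e.2 e.1 -> (child e i).2 \in rem e.1 (nbr e.2).
Proof. by move=> ae; rewrite mem_nth // size_rem_nbr. Qed.

Lemma child_adj e i : adj e.2 e.1 -> adj e.2 (child e i).2 /\ (child e i).2 <> e.1.
Proof.
move=> ae; have := child_mem i ae; rewrite mem_rem_uniq // !inE nbr_adj.
by case/andP => /eqP.
Qed.

Lemma child_valid e i : adj e.2 e.1 -> adj (child e i).2 (child e i).1.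
Proof. by move=> /(child_adj i)[]; rewrite adj_sym. Qed.

Lemma child_surj e w : adj e.2 e.1 -> adj e.2 w -> w <> e.1 ->
  exists i, w = (child e i).2.
Proof.
move=> ae ew /eqP we.
have wr : w \in rem e.1 (nbr e.2) by rewrite mem_rem_uniq // !inE we nbr_adj.
have := wr; rewrite -index_mem size_rem_nbr // => iw.
by exists (Ordinal iw); rewrite /= nth_index.
Qed.

Lemma child_inj e i j : adj e.2 e.1 -> (child e i).2 = (child e j).2 -> i = j.
Proof.
move=> ae /eqP; rewrite /= nth_uniq ?size_rem_nbr ?rem_uniq //.
by move=> /eqP/val_inj.
Qed.

Lemma decode_valid e s : adj e.2 e.1 -> adj (decode e s).2 (decode e s).1.
Proof.
move=> ae; elim/last_ind: s => // s i IH; rewrite decode_rcons; exact: child_valid.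
Qed.

Lemma decode_branch e s : adj e.2 e.1 -> branch e.1 e.2 (decode e s).2.
Proof.
elim: s e => [|i s IH] e ae /=; first exact: branch_root.
have [a1 a2] := child_adj i ae.
exact: (branch_sub ae a1 a2 (IH _ (child_valid i ae))).
Qed.

(** Words with different first letters end in disjoint branches, and a nonempty word never leads
    back to the root. *)
Lemma decode_inj e s t : adj e.2 e.1 -> (decode e s).2 = (decode e t).2 -> s = t.
Proof.
have nroot i (e0 : T * T) s0 : adj e0.2 e0.1 -> e0.2 <> (decode (child e0 i) s0).2.
  move=> ae E; have ca := child_valid i ae.
  by apply: (branch_outer ca); have := decode_branch s0 ca; rewrite -E.
elim: s t e => [|i s IH] [|j t] e ae //=.
- by move=> /(nroot _ _ _ ae).
- by move=> /esym/(nroot _ _ _ ae).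
- have [-> E|ij E] := eqVneq i j; first by rewrite (IH t _ (child_valid j ae) E).
  exfalso; have [a1 _] := child_adj i ae; have [a2 _] := child_adj j ae.
  have := decode_branch s (child_valid i ae); rewrite [decode _ s]lock /= -lock E.
  apply: branch_disjoint a2 a1 _ (decode_branch t (child_valid j ae)).
  by move=> /(child_inj ae) ji; rewrite ji eqxx in ij.
Qed.

Lemma decode_adj e s w : adj e.2 e.1 -> adj (decode e s).2 w ->
  (exists i, w = (decode e (rcons s i)).2) \/ w = (decode e s).1.
Proof.
move=> ae sw; have [->|we] := eqVneq w (decode e s).1; [by right|left].
have [i ->] := child_surj (decode_valid s ae) sw (elimN eqP we).
by exists i; rewrite decode_rcons.
Qed.

Lemma decode_parent e s i : (decode e (rcons s i)).1 = (decode e s).2.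
Proof. by rewrite decode_rcons. Qed.

Lemma decode_surj e w : adj e.2 e.1 -> branch e.1 e.2 w ->
  exists s, (decode e s).2 = w.
Proof.
move=> ae; have cY := branch_cut hT ae; have [_ _ Y1 bY] := cY.
suff : forall v, ~ branch e.1 e.2 v \/ exists s, (decode e s).2 = v.
  by move=> /(_ w)[].
apply: (tree_connected hT (x := e.1)); last by left.
move=> a b ab [Ya|[s sa]].
  have [Yb|] := pselect (branch e.1 e.2 b); [right|by left].
  by exists [::]; rewrite adj_sym in ab; have [-> _] := bY _ _ ab Yb Ya.
rewrite -sa in ab; have [[i ->]|->] := decode_adj ae ab.
  by right; exists (rcons s i).
case/lastP: s {sa ab} => [|s i]; first by left.
by right; exists s; rewrite decode_parent.
Qed.

(** Both branches at [u] are coded by the same words, so exchanging the two codings is an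
    involution. It keeps adjacency because neighbours inside a branch differ by one final letter,
    while the roots are joined to the fixed vertex [u]. *)
Lemma branch_swap u y z : adj u y -> adj u z -> y <> z ->
  exists f : autom T, [/\ f y = z, f z = y &
    forall w, ~ branch u y w -> ~ branch u z w -> f w = w].
Proof.
move=> uy uz yz; have yu : adj y u by rewrite adj_sym.
have zu : adj z u by rewrite adj_sym.
(* The default word is never reached: [f] uses [code] only inside the branch concerned, where a word
   exists by [decode_surj]. *)
pose code e w := xget [::] [set s | (decode e s).2 = w].
have codeK e s : adj e.2 e.1 -> code e (decode e s).2 = s.
  by move=> ae; apply: xget_unique => // t; exact: decode_inj.
pose f w := if `[< branch u y w >] then (decode (u, z) (code (u, y) w)).2 else
            if `[< branch u z w >] then (decode (u, y) (code (u, z) w)).2 else w.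
have fy s : f (decode (u, y) s).2 = (decode (u, z) s).2.
  rewrite /f; case: asboolP => [_|[]]; first by rewrite codeK.
  exact: (@decode_branch (u, y)).
have fz s : f (decode (u, z) s).2 = (decode (u, y) s).2.
  have Z := @decode_branch (u, z) s zu.
  rewrite /f; case: asboolP => [Y|_]; first by have := branch_disjoint uy uz yz Y Z.
  by case: asboolP => // _; rewrite codeK.
have fo w : ~ branch u y w -> ~ branch u z w -> f w = w.
  by move=> Y Z; rewrite /f; case: asboolP => // _; case: asboolP.
have fu : f u = u by apply: fo; apply: branch_outer.
have fK : involutive f.
  move=> w; have [Y|Y] := pselect (branch u y w).
    by have [s <-] := @decode_surj (u, y) w yu Y; rewrite fy fz.
  have [Z|Z] := pselect (branch u z w).
    by have [s <-] := @decode_surj (u, z) w zu Z; rewrite fz fy.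
  by rewrite !fo.
have hom a b : adj a u -> adj b u ->
    (forall s, f (decode (u, a) s).2 = (decode (u, b) s).2) ->
    forall v w, branch u a v -> adj v w -> adj (f v) (f w).
  move=> au bu fab v w Yv vw.
  have [s sv] := @decode_surj (u, a) v au Yv; rewrite -sv in vw *.
  have [[i ->]|->] := @decode_adj (u, a) s w au vw.
    rewrite !fab decode_rcons; apply: (child_adj i _).1; exact: (@decode_valid (u, b)).
  case/lastP: s {sv vw} => [|s i]; first by rewrite (fab [::]) /= fu.
  rewrite decode_parent !fab -(decode_parent (u, b) s i).
  exact: (@decode_valid (u, b)).
have hom2 v w : adj v w -> adj (f v) (f w).
  move=> vw.
  have [Y|Yv] := pselect (branch u y v); first exact: (hom y z).
  have [Z|Zv] := pselect (branch u z v); first exact: (hom z y).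
  rewrite adj_sym; rewrite adj_sym in vw.
  have [Y|Yw] := pselect (branch u y w); first exact: (hom y z).
  have [Z|Zw] := pselect (branch u z w); first exact: (hom z y).
  by rewrite !fo.
have fadj v w : adj (f v) (f w) = adj v w.
  by apply/idP/idP => /hom2 //; rewrite !fK.
exists (Autom (inv_bij fK) fadj); split=> //=.
- exact: fy [::].
- exact: fz [::].
Qed.

(** * Subgroups containing vertex stabilizers *)

Section DenseSubgroup.
Hypothesis hk : (3 <= k)%N.
Context (H : set (autom T)) (Hgrp : is_subgroup H).

Let HM g h : H g -> H h -> H (g * h)%g. Proof. by case: Hgrp => _ + _; apply. Qed.
Let HV g : H g -> H (g^-1)%g. Proof. by case: Hgrp => _ _; apply. Qed.

Let HMl g h : H g -> H (g * h)%g -> H h.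
Proof. by move=> /HV Hg /(HM Hg); rewrite mulgA mulVg mul1g. Qed.

Let HMr g h : H h -> H (g * h)%g -> H g.
Proof. by move=> /HV Hh /HM/(_ Hh); rewrite -mulgA mulgV mulg1. Qed.

Definition contains_stabilizer u := forall g, g u = u -> H g.

(** If [g] also fixes [y], it splits into a factor on each side of the edge between [u] and [y]. If
    [g y] is neither [y] nor [z], swapping the branches of [g y] and [y], which lie in [branch z u],
    reduces to that case. If [g y] is [z], a swap inside [branch y u] first moves [z] to a third
    neighbour. *)
Lemma stabilizer_from_branches u y z : adj u y -> adj u z -> y <> z ->
  (forall g, supported (branch y u) g -> H g) ->
  (forall g, supported (branch z u) g -> H g) -> contains_stabilizer u.
Proof.
move=> uy uz yz Hy Hz.
have swap_fix a b (f : autom T) : adj u a -> adj u b ->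
    (forall w, ~ branch u a w -> ~ branch u b w -> f w = w) -> f u = u.
  by move=> ua ub; apply; apply: branch_outer; rewrite adj_sym.
have step1 g : g u = u -> g y = y -> H g.
  move=> gu gy; have cY := branch_cut hT uy.
  have [h sh hg] := restriction cY (preserves_of_edge cY gu gy).
  suff Hg : H (h^-1 * g)%g by rewrite -(mulVKg h g); apply: HM => //; apply: Hy.
  apply: Hz => w Yw; rewrite automM -hg ?automK //.
  have [//|Y'w] := pselect (branch y u w); exfalso; apply: Yw.
  apply: (branch_sub uz uy yz); by rewrite branchC.
have step2 g : g u = u -> g y <> z -> H g.
  move=> gu gyz; have [gy|/eqP gy] := eqVneq (g y) y; first exact: step1.
  have ugy : adj u (g y) by rewrite -{1}gu autom_adj.
  have [f [fg fy fo]] := branch_swap ugy uy gy.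
  have Hf : H f.
    apply: Hz => w Zw; apply: fo; apply: contra_not Zw; exact: branch_sub.
  apply: (HMl Hf); apply: step1; rewrite automM //.
  by rewrite gu; exact: swap_fix fo.
move=> g gu; have [gyz|/eqP gyz] := eqVneq (g y) z; last exact: step2.
have [q [uq /eqP qy /eqP qz]] : exists q, [/\ adj u q, q != y & q != z].
  apply: contrapT => nq; have : (size (nbr u) <= size [:: y; z])%N.
    apply: uniq_leq_size => // q; rewrite nbr_adj !inE => uq.
    by apply: contrapT => /negP; rewrite negb_or => /andP[qy qz]; apply: nq; exists q.
  by rewrite nbr_size leqNgt hk.
have [f [fz fq fo]] := branch_swap uz uq (nesym qz).
have Hf : H f.
  apply: Hy => w Yw; apply: fo; apply: contra_not Yw; apply: branch_sub => //.
  exact: nesym.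
apply: (HMl Hf); apply: step2; rewrite automM ?gyz ?fz //.
by rewrite gu; exact: swap_fix fo.
Qed.

(** The property spreads along edges: if the stabilizers of [a] and of its neighbour [a'] lie in
    [H], a swap fixing [a] conjugates the stabilizer of any other neighbour of [a] into that of
    [a']. *)
Lemma stabilizers_from_edge u v : adj u v ->
  contains_stabilizer u -> contains_stabilizer v ->
  forall w, contains_stabilizer w.
Proof.
move=> uv Hu Hv w0.
suff : forall w, contains_stabilizer w /\
    exists2 w', adj w w' & contains_stabilizer w' by move=> /(_ w0)[].
apply: (tree_connected hT (x := u)); last by split=> //; exists v.
move=> a b ab [Ha [a' aa' Ha']]; split; last by exists a => //; rewrite adj_sym.
have [<-//|/eqP ba] := eqVneq a' b.
have [f [fa' fb fo]] := branch_swap aa' ab ba.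
have Hf : H f by apply: Ha; apply: fo; apply: branch_outer; rewrite adj_sym.
move=> g gb; apply: (HMl Hf); apply: (HMr (HV Hf)); apply: Ha'.
by rewrite !automM -{1}fb automK gb fb.
Qed.

(** The class is given by the parity of the distance to [x]. It is the parity of the word length on
    the side of [x], and the opposite parity on the side of [x'], whose words start one step further
    away. *)
Lemma bipartition_class_exists x : exists2 A, bipartition_class A & A x.
Proof.
have [x' xx'] : exists x', adj x x'.
  case E : (nbr x) (nbr_size x) (nbr_adj x) => [|x' s] sz mem.
    by have := hk; rewrite -sz.
  by exists x'; rewrite -mem inE eqxx.
have x'x : adj x' x by rewrite adj_sym.
pose e := (x', x); pose e' := (x, x').
pose C (c : bool) w := exists s,
  ((decode e s).2 = w /\ odd (size s) = c) \/
  ((decode e' s).2 = w /\ odd (size s) = ~~ c).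
have Y s : branch x' x (decode e s).2 by exact: (@decode_branch e s xx').
have Y' s : ~ branch x' x (decode e' s).2.
  by have := @decode_branch e' s x'x; rewrite /= (branchC xx').
have Cfun c c' w : C c w -> C c' w -> c = c'.
  move=> [s [[<- <-]|[<- cs]]] [t [[E <-]|[E ct]]].
  - by rewrite (@decode_inj e _ _ xx' E).
  - by have := Y s; rewrite -E => /Y'.
  - by have := Y t; rewrite E => /Y'.
  - by apply: negb_inj; rewrite -cs -ct (@decode_inj e' _ _ x'x E).
have Ctot w : exists c, C c w.
  have [Yw|Yw] := pselect (branch x' x w).
    by have [s E] := @decode_surj e _ xx' Yw; exists (odd (size s)), s; left.
  have {}Yw : branch x x' w by rewrite (branchC xx').
  have [s E] := @decode_surj e' _ x'x Yw.
  by exists (~~ odd (size s)), s; right; rewrite negbK.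
have Calt v w c : adj v w -> C c v -> C (~~ c) w.
  move=> vw [s [[E <-]|[E cs]]]; rewrite -E in vw.
    have [[i ->]|->] := @decode_adj e s w xx' vw.
      by exists (rcons s i); left; rewrite size_rcons.
    case/lastP: s {vw E} => [|s i]; first by exists [::]; right.
    by exists s; left; rewrite decode_parent size_rcons /= negbK.
  have [[i ->]|->] := @decode_adj e' s w x'x vw.
    by exists (rcons s i); right; rewrite size_rcons /= cs.
  case/lastP: s {vw E} cs => [|s i] cs; first by exists [::]; left.
  exists s; right; rewrite decode_parent -cs size_rcons /= negbK.
  by [].
exists (C false); last by exists [::]; left.
move=> v w vw; split=> [Cv Cw|Cw].
  by have := Cfun _ _ _ (Calt _ _ _ vw Cv) Cw.
have [[] Cv //] := Ctot v; case: Cw; exact: Calt vw Cv.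
Qed.

(** The stabilizer of a vertex permutes its neighbours transitively, so [H] is transitive on the
    class of [x]. Some [h] in [H] thus agrees with [g] at [x], and [h^-1 g] fixes [x]. *)
Lemma aut0_sub : (forall w, contains_stabilizer w) -> @aut0 T `<=` H.
Proof.
move=> HS g g0; have [[x _] _ _] := hT.
have [A bA Ax] := bipartition_class_exists x.
suff Q w : (A w -> exists2 h, H h & h x = w) /\
    (~ A w -> forall v, adj w v -> exists2 h, H h & h x = v).
  have Agx : A (g x) by rewrite -(g0 A bA); exists x.
  have [/(_ Agx)[h Hh hx] _] := Q (g x); apply: (HMl (HV Hh)); apply: (HS x).
  by rewrite automM -hx automK.
move: w; apply: (tree_connected hT (x := x)); last first.
  split=> // _; exists 1%g => //; by case: Hgrp.
move=> v w vw [IH1 IH2]; split.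
  by move=> Aw; apply: IH2 => // Av; exact: (bA _ _ vw).1 Av Aw.
move=> Aw u wu; have [h Hh hx] : exists2 h, H h & h x = v.
  by apply: IH1; exact: (bA _ _ vw).2.
have [vu|/eqP vu] := eqVneq v u; first by exists h => //; rewrite -vu.
rewrite adj_sym in vw; have [f [fv _ fo]] := branch_swap vw wu vu.
exists (f * h)%g; last by rewrite automM hx.
apply: HM => //; apply: (HS w); apply: fo; apply: branch_outer; by rewrite adj_sym.
Qed.

End DenseSubgroup.
End Regular.

(** * Prescribing the first return of an elliptic automorphism *)

Section FirstReturn.
Context (T : sgraph) (hT : is_tree T) (nbr : T -> seq T).
Hypothesis nbr_adj : forall x y, (y \in nbr x) = adj x y.
Implicit Types (x y w p q r : T) (Y Z : set T) (a b g : autom T) (s B F : seq T).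

Definition ball n s : seq T :=
  iter n (fun B => B ++ flatten (map nbr B)) s.

Lemma ball_next n s v w : v \in ball n s -> adj v w -> w \in ball n.+1 s.
Proof.
move=> vs vw; rewrite /= mem_cat; apply/orP; right.
by apply/flatten_mapP; exists v => //; rewrite nbr_adj.
Qed.

Lemma ballS n m s w : (n <= m)%N -> w \in ball n s -> w \in ball m s.
Proof.
elim: m => [|m IH]; first by rewrite leqn0 => /eqP->.
by rewrite leq_eqVlt => /orP[/eqP->//|/IH{}IH /IH ws]; rewrite /= mem_cat ws.
Qed.

Lemma ball_stable g n s : (forall w, w \in s -> g w \in s) ->
  forall w, w \in ball n s -> g w \in ball n s.
Proof.
move=> gs; elim: n => //= n IH w.
rewrite !mem_cat => /orP[/IH ->//|/flatten_mapP[v vb vw]].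
apply/orP; right; apply/flatten_mapP; exists (g v); first exact: IH.
by rewrite nbr_adj autom_adj -nbr_adj.
Qed.

Lemma ball_exhaust x s w : x \in s -> exists n, w \in ball n s.
Proof.
move=> xs; move: w; apply: (tree_connected hT (x := x)); last by exists 0%N.
by move=> v w vw [n vn]; exists n.+1; exact: ball_next vw.
Qed.

Lemma ball_exhaust_seq x s F : x \in s -> exists n, {subset F <= ball n s}.
Proof.
move=> xs; elim: F => [|w F [n IH]]; first by exists 0%N.
have [m wm] := ball_exhaust w xs; exists (maxn n m) => v.
rewrite inE => /orP[/eqP->|/IH vn].
  by apply: ballS wm; exact: leq_maxr.
by apply: ballS vn; exact: leq_maxl.
Qed.

(* For [e.1 = e.2] this is a fixed vertex, for [e.1], [e.2] adjacent an
   invariant edge. *)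
Definition fixes_pair (e : T * T) a :=
  (a e.1 = e.1 /\ a e.2 = e.2) \/ (a e.1 = e.2 /\ a e.2 = e.1).

Lemma fixes_pair_stable e a : fixes_pair e a ->
  forall w, w \in [:: e.1; e.2] -> a w \in [:: e.1; e.2].
Proof.
move=> ea w; rewrite !inE => /orP[]/eqP->; case: ea => -[E1 E2];
  by rewrite ?(E1, E2) eqxx ?orbT.
Qed.

Lemma fixes_pairV e a : fixes_pair e a -> fixes_pair e (a^-1)%g.
Proof.
case=> -[E1 E2]; [left|right]; split.
- by rewrite -{1}E1 automK.
- by rewrite -{1}E2 automK.
- by rewrite -E2 automK.
- by rewrite -E1 automK.
Qed.

Lemma fixes_pairX e a n : fixes_pair e a -> fixes_pair e (a ^+ n)%g.
Proof.
move=> ea; elim: n => [|n IH]; first by rewrite expg0; left.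
rewrite expgS /fixes_pair !automM.
case: ea => -[a1 a2]; case: IH => -[-> ->]; rewrite a1 a2; by [left|right].
Qed.

(** Balls around the invariant pair are finite and stable under [a], so the images of the pair
    [(p, q)] must repeat. *)
Lemma fixes_pair_periodic e a p q : fixes_pair e a ->
  exists m, [/\ (0 < m)%N, (a ^+ m)%g p = p & (a ^+ m)%g q = q].
Proof.
move=> ea; have e1 : e.1 \in [:: e.1; e.2] by rewrite inE eqxx.
have [n pqn] := ball_exhaust_seq [:: p; q] e1.
pose B := ball n [:: e.1; e.2].
have Bst i w : w \in B -> (a ^+ i)%g w \in B.
  by apply: ball_stable; apply: fixes_pair_stable; exact: fixes_pairX.
have [i [j [ij [Ep Eq]]]] := @nat_seq_collision _
  (fun i => ((a ^+ i)%g p, (a ^+ i)%g q)) [seq (v, w) | v <- B, w <- B]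
  (fun i => allpairs_f _ (Bst i p (pqn _ (mem_head _ _)))
                         (Bst i q (pqn _ (mem_last _ _)))).
exists (j - i)%N; rewrite subn_gt0 ij; split=> //; apply: (@autom_inj _ (a ^+ i)%g).
  by rewrite -automM -expgnDr subnKC ?(ltnW ij).
by rewrite -automM -expgnDr subnKC ?(ltnW ij).
Qed.

(** The half-tree and its image under [a^i] share a vertex and both miss [e.1], hence they are
    nested. A power of [a^i] preserves [Y], which turns the inclusion into an equality. *)
Lemma return_preserves e a p' p Y i w : cut p' p Y -> fixes_pair e a ->
  ~ Y e.1 -> ~ Y e.2 -> Y w -> Y ((a ^+ i)%g w) -> preserves Y (a ^+ i)%g.
Proof.
move=> cY ea Y1 Y2 Yw Yiw; set g : autom T := (a ^+ i)%g in Yiw *.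
have eg : fixes_pair e g by exact: fixes_pairX.
have Z1 : ~ (g @` Y) e.1.
  by rewrite image_autom; case: (fixes_pairV eg) => -[-> _].
have [m [m0 mp mp']] := fixes_pair_periodic p p' eg.
have pm := preserves_of_edge hT cY mp mp'.
have {m0} [n mn] : exists n, m = n.+1 by case: m m0 {mp mp' pm} => // n; exists n.
have iter_stable (h : autom T) : (forall u, Y u -> Y (h u)) ->
    forall l u, Y u -> Y ((h ^+ l)%g u).
  move=> hY; elim=> [|l IH] u Yu; first by rewrite expg0.
  by rewrite expgS automM; apply/hY/IH.
have [YZ|ZY] := cut_nested hT cY (cut_image g cY) Y1 Z1 Yiw (imageP g Yw).
  have gV u : Y u -> Y ((g^-1)%g u) by move=> /YZ /image_autom.
  move=> u; split=> [/gV|Yu]; first by rewrite automK.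
  have := iter_stable _ gV n _ ((pm u).2 Yu).
  by rewrite mn expgSr automM automXK.
have gY u : Y u -> Y (g u) by move=> Yu; apply: ZY; exists u.
move=> u; split=> [Ygu|/gY//].
by have := iter_stable _ gY n _ Ygu; rewrite -automM -expgSr -mn => /pm.
Qed.

Lemma first_return e a p' p Y : cut p' p Y -> fixes_pair e a ->
  ~ Y e.1 -> ~ Y e.2 -> exists c, [/\ (0 < c)%N, preserves Y (a ^+ c)%g &
    forall i w, (0 < i < c)%N -> Y w -> ~ Y ((a ^+ i)%g w)].
Proof.
move=> cY ea Y1 Y2.
have exP : exists c, (0 < c)%N && `[< preserves Y (a ^+ c)%g >].
  have [m [m0 mp mp']] := fixes_pair_periodic p p' ea; exists m; rewrite m0.
  by apply/asboolP; exact: (preserves_of_edge hT cY mp mp').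
case: (ex_minnP exP) => c /andP[c0 /asboolP pc] cmin; exists c; split=> //.
move=> i w /andP[i0 ic] Yw Yiw; move: ic; rewrite ltnNge => /negP; apply.
apply: cmin; rewrite i0; apply/asboolP.
exact: (return_preserves cY ea Y1 Y2 Yw Yiw).
Qed.

(** Strictly between times 0 and [c] the orbit of [w] stays outside [Y], where [g] is trivial, so
    [g] acts only at the last step. *)
Lemma first_return_mul a g Y c w : supported Y g -> (0 < c)%N ->
  (forall i w, (0 < i < c)%N -> Y w -> ~ Y ((a ^+ i)%g w)) ->
  Y w -> ((g * a) ^+ c)%g w = g ((a ^+ c)%g w).
Proof.
move=> sg; case: c => // c _ ret Yw.
suff E i : (i <= c)%N -> ((g * a) ^+ i)%g w = (a ^+ i)%g w.
  by rewrite expgS automM (E c) // automM automX1.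
elim: i => [|i IH] ic; first by rewrite !expg0.
rewrite expgS automM IH 1?ltnW // automM automX1 sg //.
by apply: ret.
Qed.

(** On [B] such a [g] amounts to a self-map of the indices of [B]. One representative is kept for
    each of these finitely many maps, with the identity as default. *)
Lemma finite_restrictions Z B (r : T) : exists S : seq (autom T),
  (forall f, f \in S -> supported Z f) /\
  forall g, supported Z g -> (forall w, w \in B -> g w \in B) ->
    exists2 f, f \in S & forall w, w \in B -> f w = g w.
Proof.
pose n := size B.
pose P (phi : {ffun 'I_n -> 'I_n}) := [set f | supported Z f /\
  forall i : 'I_n, f (nth r B i) = nth r B (phi i)].
exists [seq xget 1%g (P phi) | phi : {ffun 'I_n -> 'I_n}]; split.
  by move=> f /codomP[phi ->]; case: xgetP => [h _ []|].
move=> g sg gB.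
have ex (i : 'I_n) : exists j : 'I_n, nth r B j = g (nth r B i).
  have gi : g (nth r B i) \in B by apply/gB/mem_nth.
  have gi' := gi; rewrite -index_mem in gi'.
  by exists (Ordinal gi'); rewrite /= nth_index.
have [phi phiP] := choice ex.
exists (xget 1%g (P (finfun phi))); first exact: codom_f.
have Pg : P (finfun phi) g by split=> // i; rewrite ffunE phiP.
case: xgetP => [f _ [_ fP]|/(_ g)//] w wB.
have wB' := wB; rewrite -index_mem in wB'.
by have := fP (Ordinal wB'); rewrite ffunE phiP /= nth_index.
Qed.

(* The number [M] of trial corrections does not depend on the region [B] on
   which they must be trivial: the corrections are carried far away by powers
   of [b], where the first return of [a] to a half-tree is prescribed. *)
Lemma correction (e : T * T) b x' x Y g F : shifts b x' x Y -> supported Y g ->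
  exists M, forall B, e.1 \in B -> e.2 \in B -> exists S : seq (autom T),
    [/\ size S = M, forall f, f \in S -> forall w, w \in B -> f w = w &
      forall a, fixes_pair e a -> exists2 f, f \in S & exists j c,
        forall w, w \in F -> (b ^+ j * (f * a) ^+ c * b^-1 ^+ j)%g w = g w].
Proof.
move=> bY sg; have [i Fi] := shifts_exhaust_seq hT bY F.
pose r' := (b ^+ i)%g x'; pose r := (b ^+ i)%g x; pose Z := (b ^+ i)%g @` Y.
have ZE w : Z w <-> Y ((b^-1 ^+ i)%g w) by rewrite /Z image_autom expVgn.
have cZ : cut r' r Z by apply: cut_image; case: bY.
have {}sg : supported Z g.
  by apply: supportedS sg => w Yw; apply/ZE; exact: (shifts_subX hT bY).
have [L FL] := ball_exhaust_seq F (mem_head r [::]).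
pose B0 := ball L [:: r].
have B0st (h : autom T) : preserves Z h -> forall w, w \in B0 -> h w \in B0.
  move=> ph; apply: ball_stable => w; rewrite !inE => /eqP ->.
  by rewrite (preserves_edge cZ ph).1.
(* [Z] and [B0] are fixed before [B] is given, so the size of [S0] can serve as the uniform [M]. *)
have [S0 [S0Z S0P]] := finite_restrictions Z B0 r.
exists (size S0) => B e1B e2B; have [n Bn] := shifts_escape_seq hT bY B.
(* The half-tree [Yn] below equals [b^-n Y], which misses [B], and [beta] carries it onto
   [Z = b^i Y], which contains [F]. *)
pose j := (n + i)%N; pose beta := (b ^+ j)%g.
have Zj w : Z (beta w) <-> Y ((b ^+ n)%g w).
  by rewrite ZE /beta /j addnC expgnDr automM automXK.
pose Yn := (beta^-1)%g @` Z.
have YnE w : Yn w <-> Z (beta w) by rewrite /Yn image_autom invgK.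
have cYn : cut (beta^-1%g r') (beta^-1%g r) Yn by exact: cut_image.
exists [seq (beta^-1 * f * beta)%g | f <- S0]; split; first by rewrite size_map.
  move=> _ /mapP[f fS ->] w wB; rewrite !automM (S0Z f fS) ?automK //.
  by rewrite Zj; exact: Bn.
move=> a ea.
have [] := first_return cYn ea; [by rewrite YnE Zj; exact: Bn..|].
move=> c [c0 pc ret].
pose theta := (beta * a ^+ c * beta^-1)%g.
have ptheta : preserves Z theta.
  by move=> w; rewrite /theta !automM -YnE pc YnE automVK.
(* The correction must satisfy [h theta = g] on [Z], so [h] is [g theta^-1] cut off outside [Z]. *)
have [h sh hg] := restriction cZ
  (preservesM (supported_preserves sg) (preservesV ptheta)).
have [f fS fh] := S0P h sh (B0st h (supported_preserves sh)).
exists (beta^-1 * f * beta)%g; first exact: map_f.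
exists j, c => w wF; rewrite !automM expVgn -/beta.
have Zw : Z w by apply/ZE; exact: Fi.
rewrite (first_return_mul _ c0 ret); last by rewrite YnE automVK.
  rewrite !automM automVK.
  have -> : beta ((a ^+ c)%g ((beta^-1)%g w)) = theta w by rewrite /theta !automM.
  rewrite fh; last by apply: B0st => //; exact: FL.
  by rewrite hg ?automM ?automK //; apply/ptheta.
move=> v; rewrite YnE => nZ; by rewrite !automM (S0Z f fS) ?automK.
Qed.

End FirstReturn.

(** * Topology and Haar measure *)

Section Topology.
Context (T : sgraph).
Implicit Types (w : T) (g h : autom T) (s : seq T).

Lemma open_eval w w' : open [set g : autom T | g w = w'].
Proof.
have [V oV VE] : exists2 V : set {ptws T -> discrete_topology T}, open V &
    V = [set f | f w = w'].
  exists [set f : {ptws T -> discrete_topology T} | f w = w'] => //.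
  pose X : set (discrete_topology T) := [set w'].
  have : open ((proj w : {ptws T -> discrete_topology T} -> _) @^-1` X).
    apply: open_comp; first by move=> f _; exact: proj_continuous.
    exact: discrete_open.
  by [].
by exists V => //; rewrite VE.
Qed.

(** The sets that contain all maps agreeing with [g] on some finite list form a filter converging
    pointwise to [g]. *)
Lemma open_autom_cylinder (U : set (autom T)) g : open U -> U g ->
  exists s, forall h, (forall w, w \in s -> h w = g w) -> U h.
Proof.
move=> [V oV <-] Vg.
pose F : set_system {ptws T -> discrete_topology T} :=
  [set A | exists s, forall f : T -> T, (forall w, w \in s -> f w = g w) -> A f].
have FF : Filter F.
  split.
  - by exists [::].
  - move=> A B [s sA] [t tB]; exists (s ++ t) => f fst; split.
      by apply: sA => w ws; apply: fst; rewrite mem_cat ws.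
    by apply: tB => w wt; apply: fst; rewrite mem_cat wt orbT.
  - by move=> A B AB [s sA]; exists s => f /sA /AB.
have Fg : F --> (autom_ptws g).
  apply/cvg_sup => w A /= [B [[C oC <-] Cg] BA].
  by exists [:: w] => f fw; apply: BA; rewrite /= (fw w) // inE.
have [s sV] : F V by apply: Fg; apply: open_nbhs_nbhs.
by exists s => h hs; apply: sV.
Qed.

Lemma open_cylinder g s : open [set h : autom T | forall w, w \in s -> h w = g w].
Proof.
elim: s => [|w s IH].
  by rewrite (_ : [set _ | _] = setT); [exact: openT|apply/seteqP; split].
rewrite (_ : [set _ | _] = [set h : autom T | h w = g w] `&`
    [set h : autom T | forall w, w \in s -> h w = g w]).
  by apply: openI => //; exact: open_eval.
apply/seteqP; split=> h /= => [H|[H1 H2] v].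
  by split=> [|v vs]; apply: H; rewrite inE ?eqxx ?vs ?orbT.
by rewrite inE => /orP[/eqP->|/H2].
Qed.

Lemma open_automP (U : set (autom T)) : open U <-> forall g, U g ->
  exists s, forall h, (forall w, w \in s -> h w = g w) -> U h.
Proof.
split=> [oU g|H]; first exact: open_autom_cylinder.
rewrite openE => g /H[s sU]; apply: filterS sU _.
by apply: open_nbhs_nbhs; split; [exact: open_cylinder|].
Qed.

Lemma open_translate (U : set (autom T)) g : open U ->
  open [set h | U (g * h)%g].
Proof.
move=> /open_automP oU; apply/open_automP => h /oU[s sU]; exists s => f fh.
by apply: sU => w ws; rewrite !automM fh.
Qed.

End Topology.

(** * Open and measurable conditions on values of automorphisms *)

Section Evaluations.
Context (T : sgraph) (en : nat -> T).
Hypothesis en_surj : forall w, exists n, en n = w.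
(* [O] will be both the open sets and the measurable sets. *)
Context (X : Type) (O : set (set X)).
Hypothesis O0 : O set0.
Hypothesis OT : O setT.
Hypothesis OI : forall A B, O A -> O B -> O (A `&` B).
Hypothesis OU : forall F : nat -> set X, (forall n, O (F n)) -> O (\bigcup_n F n).
Implicit Types (w : T) (Y : set T) (s : seq T) (g : autom T) (phi psi : X -> autom T).

Definition evaluates phi := forall w w', O [set z | phi z w = w'].

(** As [T] is countable, an arbitrary condition on the value is a countable union of conditions
    fixing that value. *)
Lemma evaluates_pred phi w (Q : set T) : evaluates phi -> O [set z | Q (phi z w)].
Proof.
move=> ephi.
have -> : [set z | Q (phi z w)] =
    \bigcup_n (if `[< Q (en n) >] then [set z | phi z w = en n] else set0).
  apply/seteqP; split=> z /=.
    have [n En] := en_surj (phi z w); rewrite -En => Qn; exists n => //.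
    by case: asboolP.
  by move=> [n _]; case: asboolP => //= Qn ->.
by apply: OU => n; case: asboolP.
Qed.

Lemma evaluates_pred2 phi psi v w (Q : T -> set T) : evaluates phi ->
  evaluates psi -> O [set z | Q (phi z v) (psi z w)].
Proof.
move=> ephi epsi.
have -> : [set z | Q (phi z v) (psi z w)] =
    \bigcup_n ([set z | phi z v = en n] `&` [set z | Q (en n) (psi z w)]).
  apply/seteqP; split=> z /=.
    by have [n En] := en_surj (phi z v); exists n => //=; rewrite En.
  by move=> [n _ [/= ->]].
by apply: OU => n; apply: OI => //; exact: evaluates_pred.
Qed.

Lemma evaluates_mul phi psi : evaluates phi -> evaluates psi ->
  evaluates (fun z => phi z * psi z)%g.
Proof.
move=> ephi epsi w w'.
have -> : [set z | (phi z * psi z)%g w = w'] =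
    \bigcup_n ([set z | psi z w = en n] `&` [set z | phi z (en n) = w']).
  apply/seteqP; split=> z /=.
    by have [n En] := en_surj (psi z w); exists n => //=; rewrite En.
  by move=> [n _ [/= E <-]]; rewrite E.
by apply: OU => n; exact: OI.
Qed.

Lemma evaluates_inv phi : evaluates phi -> evaluates (fun z => (phi z)^-1)%g.
Proof.
move=> ephi w w'; have -> : [set z | (phi z)^-1%g w = w'] = [set z | phi z w' = w].
  by apply/seteqP; split=> z /= <-; [exact: automVK|exact: automK].
exact: ephi.
Qed.

Lemma evaluates_cst g : evaluates (fun=> g).
Proof.
move=> w w'; have [E|E] := pselect (g w = w').
  by rewrite (_ : [set _ | _] = setT)//; apply/seteqP; split.
by rewrite (_ : [set _ | _] = set0)//; apply/seteqP; split.
Qed.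

Lemma evaluates_exp phi n : evaluates phi -> evaluates (fun z => phi z ^+ n)%g.
Proof.
move=> ephi; elim: n => [|n IH].
  by rewrite (_ : (fun _ => _) = fun=> 1%g); [exact: evaluates_cst|apply/funext].
rewrite (_ : (fun _ => _) = fun z => (phi z * phi z ^+ n)%g).
  exact: evaluates_mul.
by apply/funext => z; rewrite expgS.
Qed.

Lemma evaluates_seq phi g s : evaluates phi ->
  O [set z | forall w, w \in s -> phi z w = g w].
Proof.
move=> ephi; elim: s => [|w s IH].
  by rewrite (_ : [set _ | _] = setT)//; apply/seteqP; split.
rewrite (_ : [set _ | _] = [set z | phi z w = g w] `&`
    [set z | forall w, w \in s -> phi z w = g w]); first exact: OI.
apply/seteqP; split=> z /= => [H|[H1 H2] v].
  by split=> [|v vs]; apply: H; rewrite inE ?eqxx ?vs ?orbT.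
by rewrite inE => /orP[/eqP->|/H2].
Qed.

(** This is the set [B] of the outline, with the pair fixed by [a] and the axis edge of [b]
    prescribed. Both automorphisms are kept as variables so that sets of pairs can be treated as
    well. *)
Definition unapproximated (e : T * T) x' x Y g s (a b : autom T) :=
  [/\ fixes_pair e a, shifts b x' x Y & forall j c,
      ~ forall w, w \in s -> (b ^+ j * a ^+ c * b^-1 ^+ j)%g w = g w].

Lemma unapproximated_compl phi psi e x' x Y g s : evaluates phi -> evaluates psi ->
  O (~` [set z | unapproximated e x' x Y g s (phi z) (psi z)]).
Proof.
move=> ephi epsi.
have OU2 A B : O A -> O B -> O (A `|` B).
  move=> OA OB; rewrite -bigcup2E; apply: OU => n.
  by rewrite /bigcup2; case: ifP => // _; case: ifP.
have -> : ~` [set z | unapproximated e x' x Y g s (phi z) (psi z)] =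
    (([set z | ~ cut x' x Y] `|` [set z | Y (psi z x)]) `|`
    ([set z | Y (psi z x')] `|` [set z | ~ Y ((psi z)^-1%g x)])) `|`
    (([set z | ~ ((phi z e.1 = e.1 /\ phi z e.2 = e.2) \/
                 (phi z e.1 = e.2 /\ phi z e.2 = e.1))]) `|`
    \bigcup_j \bigcup_c [set z | forall w, w \in s ->
       (psi z ^+ j * phi z ^+ c * (psi z)^-1 ^+ j)%g w = g w]).
  apply/seteqP; split=> z /=.
    apply: contra_notP => /not_orP[/not_orP[/not_orP[n1 n2] /not_orP[n3 n4]]].
    move=> /not_orP[n5 n6]; split.
    - by apply: contrapT.
    - by split=> //; apply: contrapT.
    - by move=> j c H; apply: n6; exists j => //; exists c.
  move=> H [h5 [h1 h2 h3 h4] h6]; move: H.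
  by case=> [[[|]|[|]]|[|[j _ [c _]]]] //; exact: h6.
apply: (OU2); apply: (OU2).
- apply: (OU2); last exact: evaluates_pred.
  have [E|E] := pselect (cut x' x Y).
    by rewrite (_ : [set _ | _] = set0)//; apply/seteqP; split=> // z.
  by rewrite (_ : [set _ | _] = setT)//; apply/seteqP; split.
- apply: (OU2); first exact: evaluates_pred.
  by apply: (evaluates_pred _ (fun v => ~ Y v)); exact: evaluates_inv.
- exact: (evaluates_pred2 _ _ (fun v w => ~ ((v = e.1 /\ w = e.2) \/
     (v = e.2 /\ w = e.1)))).
- apply: OU => j; apply: OU => c; apply: evaluates_seq.
  apply: evaluates_mul; first apply: evaluates_mul; apply: evaluates_exp => //.
  exact: evaluates_inv.
Qed.

End Evaluations.

(** * Nullity of the exceptional set for a fixed hyperbolic element *)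

Section Null.
Context (T : sgraph) (hT : is_tree T) (nbr : T -> seq T) (en : nat -> T).
Hypothesis nbr_adj : forall x y, (y \in nbr x) = adj x y.
Hypothesis en_surj : forall w, exists n, en n = w.
Context (R : realType) (mu : {measure set (autom T) -> \bar R}).
Hypothesis mu_invariant : forall (g : autom T) (A : set (autom T)),
  measurable A -> mu ((fun h => g * h)%g @` A) = mu A.
Hypothesis mu_stab : forall v : T, mu (vertex_stabilizer v) = 1%E.
Implicit Types (a b g f : autom T) (A U : set (autom T)) (S : seq (autom T)).
Local Open Scope ereal_scope.

Lemma open_measurable_autom U : open U -> measurable U.
Proof. exact: sub_sigma_algebra. Qed.

(** The set is either empty or a left coset of the stabilizer of [v]. *)
Lemma measure_eval_le1 v w : mu [set a : autom T | a v = w] <= 1.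
Proof.
have [[g gvw]|ng] := pselect (exists g : autom T, g v = w); last first.
  rewrite (_ : [set _ | _] = set0) ?measure0 //.
  by apply/seteqP; split=> // a av; apply: ng; exists a.
have mS : measurable (vertex_stabilizer v).
  by apply: open_measurable_autom; exact: open_eval.
rewrite -(mu_stab v) -(mu_invariant g mS) le_eqVlt; apply/orP; left; apply/eqP.
congr (mu _); apply/seteqP; split=> [a /= av|_ [h /= hv <-]].
  exists (g^-1 * a)%g; last by rewrite mulVKg.
  by change ((g^-1)%g (a v) = v); rewrite av -gvw automK.
by change (g (h v) = w); rewrite hv.
Qed.

Lemma measure_translates_le S U : open U ->
  measurable [set a | exists2 f, f \in S & U (f * a)%g] /\
  mu [set a | exists2 f, f \in S & U (f * a)%g] <= (size S)%:R%:E * mu U.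
Proof.
move=> oU; elim: S => [|f S [mS IH]].
  rewrite (_ : [set _ | _] = set0).
    by split; [exact: measurable0 | rewrite measure0 mul0e].
  by apply/seteqP; split=> // a [].
pose V := [set a | U (f * a)%g].
have VE : V = (fun h => f^-1 * h)%g @` U.
  apply/seteqP; split=> [a Va|_ [h Uh <-]]; last by rewrite /V /= mulVKg.
  by exists (f * a)%g => //; rewrite mulKg.
have mV : measurable V by apply: open_measurable_autom; exact: open_translate.
rewrite (_ : [set _ | _] =
    V `|` [set a | exists2 f, f \in S & U (f * a)%g]); last first.
  apply/seteqP; split=> a /=.
    by move=> [h]; rewrite inE => /orP[/eqP->|hS]; [left|right; exists h].
  by move=> [Va|[h hS Uh]]; [exists f|exists h] => //; rewrite inE ?eqxx ?hS ?orbT.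
split; first exact: measurableU.
apply: (le_trans (measureU2 _ mV mS)).
rewrite /= -natr1 EFinD ge0_muleDl ?lee_fin // mul1e addeC leeD //.
by rewrite VE mu_invariant //; exact: open_measurable_autom.
Qed.

Lemma unapproximated_closed e x' x Y g (s : seq T) b :
  open (~` [set a | unapproximated e x' x Y g s a b]).
Proof.
apply: (@unapproximated_compl T en en_surj (autom T) (@open (autom T))
  open0 openT (@openI _) _ id (fun=> b)).
- by move=> F oF; apply: bigcup_open => n _.
- exact: open_eval.
- exact: (evaluates_cst open0 openT).
Qed.

Lemma unapproximated_null e x' x Y g (s : seq T) b : supported Y g ->
  mu [set a | unapproximated e x' x Y g s a b] = 0.
Proof.
move=> sg; set B := [set a | _].
have oB : open (~` B) by exact: unapproximated_closed.
have mB : measurable B.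
  by rewrite -[B]setCK; apply: measurableC; exact: open_measurable_autom.
have [sh|nsh] := pselect (shifts b x' x Y); last first.
  by rewrite (_ : B = set0) ?measure0 //; apply/seteqP; split=> // a [].
have [M corr] := correction hT nbr_adj e s sh sg.
pose ea := [:: e.1; e.2].
(* Open neighbourhoods of [B] that decrease to [B], because [B] is closed and the balls exhaust the
   tree. *)
pose D n := [set a : autom T | exists2 a0 : autom T, B a0 &
  forall w, w \in ball nbr n ea -> a w = a0 w].
pose C n : set (autom T) := D n `\` B.
have oD n : open (D n).
  by apply/open_automP => a [a0 Ba0 aa0]; exists (ball nbr n ea) => h ha;
     exists a0 => // w wn; rewrite ha // aa0.
have oC n : open (C n) by rewrite /C setDE; exact: openI.
have mC n : measurable (C n) by exact: open_measurable_autom.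
have BD n : B `<=` D n by move=> a Ba; exists a.
have DX a : (forall n, D n a) -> B a.
  move=> Da; apply: contrapT => nBa.
  have [t tB] := (open_automP (~` B)).1 oB a nBa.
  have [n tn] := ball_exhaust_seq hT nbr_adj t (mem_head e.1 [:: e.2]).
  have [a0 Ba0 aa0] := Da n.
  by apply: (tB a0) Ba0 => w wt; rewrite aa0 // tn.
have C0 : \bigcap_n C n = set0.
  apply/seteqP; split=> // a aC; have [_ nB] := aC 0%N I; apply: nB.
  by apply: DX => n; case: (aC n I).
have Dfix n a : D n a -> fixes_pair e a.
  move=> [a0 [e0 _ _] aa0]; rewrite /fixes_pair !aa0 //.
    by apply: (@ballS _ _ 0 n) => //; rewrite !inE eqxx orbT.
  by apply: (@ballS _ _ 0 n) => //; rewrite !inE eqxx.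
(* Every element of [D 0] sends [e.1] to [e.1] or [e.2]. Finiteness is what allows continuity from
   above in [cvC]. *)
have Cnear : mu (C 0%N) < +oo.
  pose E w := [set a : autom T | a e.1 = w].
  have mE w : measurable (E w) by apply: open_measurable_autom; exact: open_eval.
  suff H : mu (C 0%N) <= 1 + 1 by apply: le_lt_trans H _; rewrite ltry.
  apply: (@le_trans _ _ (mu (E e.1 `|` E e.2))).
    apply: le_measure; rewrite ?inE //; first exact: measurableU.
    by move=> a [/Dfix[[]|[]] E1 _ _]; [left|right].
  apply: (le_trans (measureU2 _ (mE _) (mE _))).
  by apply: leeD; exact: measure_eval_le1.
have cvC : (mu \o C) @ \oo --> 0.
  rewrite -(measure0 mu) -C0; apply: nonincreasing_cvg_mu => //.
    by rewrite C0; exact: measurable0.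
  move=> n m nm; apply/subsetPset => a [[a0 Ba0 aa0] nB]; split=> //.
  by exists a0 => // w wn; apply: aa0; exact: ballS wn.
(* For [a] in [B] the correction [f] is trivial on the ball, which [a] preserves; hence [f a] agrees
   with [a] there and lies in [D n], but no longer in [B]. So [B] is covered by [M] translates of
   [C n]. *)
have bound n : mu B <= M%:R%:E * mu (C n).
  have inb w : w \in ea -> w \in ball nbr n ea by exact: (@ballS _ _ 0 n).
  have [|| S [<- Sfix Scorr]] := corr (ball nbr n ea).
  - by apply: inb; rewrite !inE eqxx.
  - by apply: inb; rewrite !inE eqxx orbT.
  have [mS leS] := measure_translates_le S (oC n).
  apply: le_trans leS; apply: le_measure; rewrite ?inE // => a Ba.
  have ea0 : fixes_pair e a by case: Ba.
  have [f fS [j [c fgood]]] := Scorr a ea0; exists f => //; split.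
    exists a => // w wn; rewrite automM Sfix //.
    by apply: ball_stable wn => //; exact: fixes_pair_stable.
  by case=> _ _ /(_ j c).
apply/eqP; rewrite -measure_le0.
have cvMC : (fun n => M%:R%:E * mu (C n)) @ \oo --> M%:R%:E * 0 by exact: cvgeZl.
by rewrite mule0 in cvMC; apply: (cvge_to_ge cvMC); exact: nearW.
Qed.

End Null.

(** * Density and the exceptional set *)

Lemma regular_neighbours (k : nat) (T : sgraph) : regular_graph k T ->
  exists nbr : T -> seq T, [/\ forall x y, (y \in nbr x) = adj x y,
    forall x, uniq (nbr x) & forall x, size (nbr x) = k].
Proof.
move=> reg; exists (fun x => finmap.enum_fset (fset_set [set y | adj x y])); split=> x.
- move=> y; rewrite in_fset_set; last by apply/finite_setP; exists k; exact: reg.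
  by apply/idP/idP; rewrite inE.
- exact: finmap.fset_uniq.
- exact: card_fset_set (reg x).
Qed.

Lemma tree_enumeration (T : sgraph) (nbr : T -> seq T) : is_tree T ->
  (forall x y, (y \in nbr x) = adj x y) ->
  exists en : nat -> T, forall w, exists n, en n = w.
Proof.
move=> hT nbr_adj; have [[x _] _ _] := hT.
exists (fun n => let: (m, i) := odflt (0%N, 0%N) (unpickle n) in
  nth x (ball nbr m [:: x]) i) => w.
have [m wm] := ball_exhaust hT nbr_adj w (mem_head x [::]).
by exists (pickle (m, index w (ball nbr m [:: x]))); rewrite pickleK /= nth_index.
Qed.

Section GeneratedSubgroup.
Context (G : groupType) (A : set G).

Lemma generated_subgroup_subgroup : is_subgroup (generated_subgroup A).
Proof.
split=> [H [[H1 _ _]] //|x y Hx Hy H HA|x Hx H HA].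
  by case: (HA) => -[_ HM _] _; apply: HM; [exact: Hx|exact: Hy].
by case: (HA) => -[_ _ HV] _; apply: HV; exact: Hx.
Qed.

Lemma generated_subgroup_sub : A `<=` generated_subgroup A.
Proof. by move=> x Ax H [_]; exact. Qed.

Lemma subgroup_expg (H : set G) x n : is_subgroup H -> H x -> H (x ^+ n)%g.
Proof.
move=> [H1 HM _] Hx; elim: n => [|n IH]; first by rewrite expg0.
by rewrite expgS; exact: HM.
Qed.

End GeneratedSubgroup.

Section Approximation.
Context (T : sgraph) (H : set (autom T)).
Implicit Types g h : autom T.

(** This is the closure of [H], described through finite lists so that its being a subgroup is
    elementary. *)
Definition approximated : set (autom T) := [set g | forall s : seq T,
  exists2 h, H h & forall w, w \in s -> h w = g w].

Lemma approximated_closure : approximated `<=` closure H.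
Proof.
move=> g Hg U; rewrite nbhsE => -[V [oV Vg] VU].
have [s sV] := open_autom_cylinder oV Vg; have [h Hh hg] := Hg s.
by exists h; split=> //; apply/VU/sV.
Qed.

Lemma approximated_subgroup : is_subgroup H -> is_subgroup approximated.
Proof.
move=> [H1 HM HV]; split=> [s|g g' Hg Hg' s|g Hg s]; first by exists 1%g.
  have [h' Hh' h'g'] := Hg' s; have [h Hh hg] := Hg (map g' s).
  exists (h * h')%g; first exact: HM.
  by move=> w ws; rewrite !automM h'g' // hg // map_f.
have [h Hh hg] := Hg (map (g^-1)%g s); exists (h^-1)%g; first exact: HV.
move=> w ws; apply: (@autom_inj _ h).
by rewrite automVK hg ?map_f // automVK.
Qed.

End Approximation.

Lemma elliptic_fixes_pair (T : sgraph) (a : autom T) : elliptic a ->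
  exists e, fixes_pair e a.
Proof.
case=> [[x ax]|[e ee Ee]]; first by exists (x, x); left.
exists e.
have a1 : [set e.1; e.2] (a e.1) by rewrite -Ee; exists e.1 => //; left.
have a2 : [set e.1; e.2] (a e.2) by rewrite -Ee; exists e.2 => //; right.
have ne : e.1 <> e.2 by move=> E; rewrite E adj_irr in ee.
case: a1 a2 => /= a1 [] /= a2; [|by left|by right|].
  by case: ne; apply: (@autom_inj _ a); rewrite a1 a2.
by case: ne; apply: (@autom_inj _ a); rewrite a1 a2.
Qed.

Section Density.
Context (T : sgraph) (hT : is_tree T) (k : nat) (nbr : T -> seq T).
Hypothesis nbr_adj : forall x y, (y \in nbr x) = adj x y.
Hypothesis nbr_uniq : forall x, uniq (nbr x).
Hypothesis nbr_size : forall x, size (nbr x) = k.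
Hypothesis hk : (3 <= k)%N.
Implicit Types a b g : autom T.

Lemma dense_of_approximations e a b : fixes_pair e a -> hyperbolic b ->
  (forall x' x g s, supported (branch x' x) g ->
     ~ unapproximated e x' x (branch x' x) g s a b /\
     ~ unapproximated e x' x (branch x' x) g s a (b^-1)%g) ->
  @aut0 T `<=` closure (generated_subgroup [set a; b]).
Proof.
move=> ea hb approx; pose Gamma := generated_subgroup [set a; b].
have subG : is_subgroup Gamma by exact: generated_subgroup_subgroup.
have Ga : Gamma a by apply: generated_subgroup_sub; left.
have Gb : Gamma b by apply: generated_subgroup_sub; right.
have [_ GM GV] := subG.
have Gword b' j c : Gamma b' -> Gamma (b' ^+ j * a ^+ c * b'^-1 ^+ j)%g.
  move=> Gb'; apply: (GM); [apply: (GM)|]; apply: (subgroup_expg _ subG) => //.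
  exact: GV.
have app b' x' x g : Gamma b' -> shifts b' x' x (branch x' x) ->
    (forall s, ~ unapproximated e x' x (branch x' x) g s a b') ->
    approximated Gamma g.
  move=> Gb' sh unapp s; apply: contrapT => nh; apply: (unapp s); split=> // j c good.
  by apply: nh; exists (b' ^+ j * a ^+ c * b'^-1 ^+ j)%g => //; exact: Gword.
apply: subset_trans (@approximated_closure _ _).
have Hgrp := approximated_subgroup subG.
(* At an axis vertex [u] the half-tree reaching backwards is handled by [b] and the one reaching
   forwards by [b^-1]. *)
have stab u y s : min_displacement b u (y :: s) ->
    contains_stabilizer (approximated Gamma) u.
  move=> md; have [z /nesym zy [shy shz]] := axis_edges hT hb md.
  have uy : adj u y by case: shy => -[].
  have uz : adj u z by case: shz => -[].
  apply: (stabilizer_from_branches hT nbr_adj nbr_uniq nbr_size hk Hgrp uy uz zy).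
    by move=> g sg; apply: app shy _ => // s'; case: (approx _ _ _ s' sg).
  by move=> g sg; apply: app shz _ => [|s']; [exact: GV|case: (approx _ _ _ s' sg)].
have [u [y [s md]]] := min_displacement_exists hT hb.
have uy : adj u y by case: md => /andP[].
have mdy := min_displacement_next md.
have staby : contains_stabilizer (approximated Gamma) y.
  by case: (rcons s (b y)) (size_rcons s (b y)) mdy => // z t _ /stab.
apply: (aut0_sub hT nbr_adj nbr_uniq nbr_size hk Hgrp).
exact: (stabilizers_from_edge hT nbr_adj nbr_uniq nbr_size Hgrp uy
  (stab _ _ _ md) staby).
Qed.

End Density.

Lemma sigma_finite_measureP d (T : measurableType d) (R : realType)
    (m : {measure set T -> \bar R}) : sigma_finite setT m ->
  exists m' : {sigma_finite_measure set T -> \bar R},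
    (m' : set T -> \bar R) = (m : set T -> \bar R).
Proof.
move=> sf; pose H1 := isSFinite.Build _ _ _ _ (sfinite_measure_sigma_finite sf).
pose H2 := isSigmaFinite.Build _ _ _ _ sf.
by exists (HB.pack_for (SigmaFiniteMeasure.type T R) (Measure.sort m) H1 H2).
Qed.

(** Sections will be known to be null only for fixed second coordinate, so the product measure is
    first rewritten, by uniqueness, as the integral in the other order. *)
Lemma null_ysections_null d1 d2 (T1 : measurableType d1)
    (T2 : measurableType d2) (R : realType)
    (m1 : {sigma_finite_measure set T1 -> \bar R})
    (m2 : {sigma_finite_measure set T2 -> \bar R}) (N : set (T1 * T2)) :
  measurable N -> (forall y, m1 (ysection N y) = 0%E) ->
  (m1 \x m2)%E N = 0%E.
Proof.
move=> mN N0; have -> : (m1 \x m2)%E N = (m1 \x^ m2)%E N.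
  by apply: product_measure_unique => // A B mA mB; exact: product_measure2E.
by rewrite /product_measure2 integral0_eq // => y _; exact: N0.
Qed.

(** * Countable cover of the exceptional pairs by closed null strata *)

Section BadPairs.
Context (T : sgraph) (hT : is_tree T) (k : nat) (nbr : T -> seq T) (en : nat -> T).
Hypothesis nbr_adj : forall x y, (y \in nbr x) = adj x y.
Hypothesis nbr_uniq : forall x, uniq (nbr x).
Hypothesis nbr_size : forall x, size (nbr x) = k.
Hypothesis en_surj : forall w, exists n, en n = w.
Hypothesis hk : (3 <= k)%N.
Context (R : realType) (mu : {measure set (autom T) -> \bar R}).
Hypothesis hmu : haar_measure mu.
Hypothesis mu_stab : forall v : T, mu (vertex_stabilizer v) = 1%E.

(* A code names an edge or vertex [e], an edge [{x, x'}], a finite list [s], the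
   values [t] of [g] on [s], and a direction along the axis of [b]; only these
   matter for [unapproximated], so countably many conditions suffice. *)
Let code := ((nat * nat) * (nat * nat) * (seq nat * seq nat) * bool)%type.

Let pattern (c : code) : set (autom T) :=
  let: (_, (m', m), (s, t), _) := c in
  [set g | supported (branch (en m') (en m)) g /\ map g (map en s) = map en t].

Let stratum (c : code) : set (autom T * autom T) :=
  let: ((n1, n2), (m', m), (s, t), sgn) := c in
  [set ab | unapproximated (en n1, en n2) (en m') (en m) (branch (en m') (en m))
     (xget 1%g (pattern c)) (map en s) ab.1 (if sgn then ab.2 else (ab.2^-1)%g)].

Let strata n := stratum (odflt ((0, 0), (0, 0), ([::], [::]), true)%N (unpickle n)).

Let bad : set (autom T * autom T) :=
  [set ab | [/\ elliptic ab.1, hyperbolic ab.2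
              & ~ (@aut0 T `<=` closure (generated_subgroup [set ab.1; ab.2]))]].

(** If no automorphism matches the code, the default is the identity, which has support in every
    set; so every stratum falls under [unapproximated_null]. *)
Let pattern_supported m' m (g : autom T) c : (c.1.1.2 = (m', m)) ->
  supported (branch (en m') (en m)) (xget 1%g (pattern c)).
Proof.
case: c => [[[[n1 n2] [m1' m1]] [s t]] sgn] [-> ->].
by case: xgetP => [h _ []|].
Qed.

Let stratum_strata c : stratum c `<=` \bigcup_n strata n.
Proof.
move=> z cz; exists (pickle c); first exact: I.
rewrite /strata pickleK; exact: cz.
Qed.

Let bad_strata : bad `<=` \bigcup_n strata n.
Proof.
move=> [a b] [/= ella hypb nsub]; apply: contrapT => nU; apply: nsub.
have [e ea] := elliptic_fixes_pair ella.
have [en' en'K] : exists en' : T -> nat, cancel en' en.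
  by have [en' en'P] := choice en_surj; exists en'.
have mapK (s : seq T) : map en (map en' s) = s.
  by rewrite -map_comp map_id_in // => w _; exact: en'K.
apply: (dense_of_approximations hT nbr_adj nbr_uniq nbr_size hk ea hypb).
move=> x' x g s sg.
suff no sgn : ~ unapproximated e x' x (branch x' x) g s a (if sgn then b else (b^-1)%g).
  by split; [exact: (no true)|exact: (no false)].
move=> [_ sh un]; apply: nU.
pose c : code := ((en' e.1, en' e.2), (en' x', en' x),
  (map en' s, map en' (map g s)), sgn).
apply: (stratum_strata (c := c)).
(* The representative [h] chosen for the code may differ from [g], but it agrees with [g] on [s],
   which is all that matters. *)
rewrite /c /=; case: xgetP => [h _ /= [_ hg]|/(_ g)]; last first.
  by case; rewrite /= !en'K !mapK.
move: hg; rewrite !en'K !mapK => /eq_in_map hg.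
rewrite /unapproximated; split=> // j c' good; apply: (un j c') => w ws.
by rewrite -hg // good.
Qed.

Let stratumE c : exists e x' x g s, supported (branch x' x) g /\
  stratum c = [set ab | unapproximated e x' x (branch x' x) g s ab.1
    (if c.2 then ab.2 else (ab.2^-1)%g)].
Proof.
case: c => [[[[n1 n2] [m' m]] [s t]] sgn].
exists (en n1, en n2), (en m'), (en m),
  (xget 1%g (pattern ((n1, n2), (m', m), (s, t), sgn))), (map en s).
by split=> //; exact: (@pattern_supported m' m 1%g).
Qed.

Let stratum_open c : open (~` stratum c).
Proof.
have [e [x' [x [g [s [_ ->]]]]]] := stratumE c.
have e1 : evaluates (@open (autom T * autom T)%type) fst.
  move=> w w'; apply: (@open_comp _ _ fst [set a : autom T | a w = w']).
    by move=> z _; exact: cvg_fst.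
  exact: open_eval.
have e2 : evaluates (@open (autom T * autom T)%type) snd.
  move=> w w'; apply: (@open_comp _ _ snd [set a : autom T | a w = w']).
    by move=> z _; exact: cvg_snd.
  exact: open_eval.
have oU (F : nat -> set (autom T * autom T)) :
    (forall n, open (F n)) -> open (\bigcup_n F n).
  by move=> oF; apply: bigcup_open => n _.
apply: (unapproximated_compl en_surj (O := open) open0 openT (@openI _) oU
  _ _ _ _ _ _ e1 (psi := fun z => if c.2 then z.2 else (z.2^-1)%g)).
by case: c.2; [exact: e2|exact: (evaluates_inv e2)].
Qed.

Let stratum_measurable c : measurable (stratum c).
Proof.
rewrite -[stratum c]setCK; apply: measurableC.
have [e [x' [x [g [s [_ ->]]]]]] := stratumE c.
have e1 : evaluates (@measurable _ (autom T * autom T)%type) fst.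
  move=> w w'.
  have mE : measurable [set a : autom T | a w = w'].
    by apply: open_measurable_autom; exact: open_eval.
  have := @measurable_fst _ _ (autom T) (autom T) measurableT _ mE.
  by rewrite setTI.
have e2 : evaluates (@measurable _ (autom T * autom T)%type) snd.
  move=> w w'.
  have mE : measurable [set a : autom T | a w = w'].
    by apply: open_measurable_autom; exact: open_eval.
  have := @measurable_snd _ _ (autom T) (autom T) measurableT _ mE.
  by rewrite setTI.
have ec : evaluates (@measurable _ (autom T * autom T)%type)
    (fun z => if c.2 then z.2 else (z.2^-1)%g).
  by case: c.2; [exact: e2|exact: (evaluates_inv e2)].
exact: (unapproximated_compl en_surj (O := @measurable _ (autom T * autom T)%type)
  measurable0 measurableT (@measurableI _ _) (@bigcupT_measurable _ _)
  e x' x (branch x' x) g s e1 ec).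
Qed.

Let stratum_null c b : mu [set a | stratum c (a, b)] = 0%E.
Proof.
have [inv _ _] := hmu.
have [e [x' [x [g [s [sg ->]]]]]] := stratumE c.
exact: (unapproximated_null hT nbr_adj en_surj inv mu_stab e x' x s
  (if c.2 then b else (b^-1)%g) sg).
Qed.

(** The strata are closed. An interior point of one would give, at some fixed [b], a nonempty open
    set of [a] inside a null section, whereas nonempty open sets have positive measure. *)
Lemma bad_meager : meager bad.
Proof.
(* Intersecting with [bad] gives the equality required by [meager], not merely a cover. *)
exists (fun n => bad `&` strata n); last first.
  by rewrite -setI_bigcupr; apply/esym/setIidPl; exact: bad_strata.
move=> n; rewrite /nowhere_dense.
have cl : closure (bad `&` strata n) `<=` strata n.
  have : closed (strata n) by rewrite -openC; exact: stratum_open.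
  by move=> /closure_id {2}->; apply: closureS; exact: subIsetr.
apply/seteqP; split=> // -[a b] /= /(interiorS cl) [[U V] /= [Ua Vb] UV].
move: Ua; rewrite nbhsE => -[W [oW Wa] WU].
have [_ _ pos] := hmu.
have : (mu W <= mu [set a | strata n (a, b)])%E.
  apply: le_measure; rewrite ?inE //; first exact: open_measurable_autom.
    have mS : measurable (strata n) by exact: stratum_measurable.
    by have := measurable_ysection b mS; rewrite ysectionE.
  move=> a' Wa'; apply: (UV (a', b)); split=> /=; first exact: WU.
  exact: nbhs_singleton.
rewrite stratum_null leNgt => /negP; apply; apply: pos => //; by exists a.
Qed.

Lemma haar_sigma_finite : sigma_finite setT mu.
Proof.
have [[v _] _ _] := hT; exists (fun n => [set g : autom T | g v = en n]).
  by apply/seteqP; split=> // g _; have [n En] := en_surj (g v); exists n.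
move=> n; split; first by apply: open_measurable_autom; exact: open_eval.
have [inv _ _] := hmu.
by apply: (le_lt_trans (measure_eval_le1 inv mu_stab v (en n))); rewrite ltry.
Qed.

Lemma bad_negligible : (mu \x mu)%E.-negligible bad.
Proof.
have mN : measurable (\bigcup_n strata n).
  by apply: bigcupT_measurable => n; exact: stratum_measurable.
exists (\bigcup_n strata n); split=> //.
have [m mE] := sigma_finite_measureP haar_sigma_finite.
rewrite -mE; apply: null_ysections_null => // b; rewrite mE ysection_bigcup.
apply: measure_negligible.
  apply: bigcupT_measurable => n; apply: measurable_ysection; exact: stratum_measurable.
apply: negligible_bigcup => n; apply/negligibleP.
  by apply: measurable_ysection; exact: stratum_measurable.
by rewrite ysectionE; exact: stratum_null.
Qed.

End BadPairs.

Theorem theorem10 (R : realType) (k : nat) (T : sgraph)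
    (mu : {measure set (autom T) -> \bar R})
    (hk : (3 <= k)%N) (hT : is_tree T) (hreg : regular_graph k T)
    (hmu : haar_measure mu)
    (hstab : forall v : T, mu (vertex_stabilizer v) = 1%E) :
  let bad : set (autom T * autom T) :=
    [set ab | [/\ elliptic ab.1, hyperbolic ab.2
                & ~ (@aut0 T `<=`
                     closure (generated_subgroup [set ab.1; ab.2]))]] in
  meager bad /\ (mu \x mu)%E.-negligible bad.
Proof.
have [nbr [nbr_adj nbr_uniq nbr_size]] := regular_neighbours hreg.
have [en en_surj] := tree_enumeration hT nbr_adj.
split.
  exact: (bad_meager hT nbr_adj nbr_uniq nbr_size en_surj hk hmu hstab).
exact: (bad_negligible hT nbr_adj nbr_uniq nbr_size en_surj hk hmu hstab).
Qed.
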